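(* Let $c\ge 0$, $d\in\{0,1,2,\dots\}$ and $\lambda>0$ be fixed, set $q=e^{-\lambda/N}$ and $\alpha=cN+d$, and let $\nu_{n,N}=\frac1n\sum_{j=1}^n\delta_{x^{(j)}_{n,N}}$ be the normalized zero counting measure of the little $q$-Laguerre polynomial $p_n(x;q^{\alpha}\,|\,q)$. Then as $n,N\to\infty$ with $n/N\to1$, for every continuous function $f$ on $[0,1]$, $\int f\,d\nu_{n,N}\to\int_0^1 f(x)\rho^{(c)}(x)\,dx$.
   Context: For $\mathsf{a}\in(0,1/q)$ the little $q$-Laguerre polynomials $p_n(x)=p_n(x;\mathsf{a}\,|\,q)$ are defined by $p_0(x)=1$, $p_1(x)=1-\frac{x}{1-\mathsf{a}q}$ and, for $n\ge1$, $q^n(1-\mathsf{a}q^{n+1})p_{n+1}(x)+\big(x-q^n(1-\mathsf{a}q^{n+1})-\mathsf{a}q^n(1-q^n)\big)p_n(x)+\mathsf{a}q^n(1-q^n)p_{n-1}(x)=0$; here $\mathsf{a}=q^{\alpha}$. $q$-deformed Marchenko–Pastur law: let $\lambda_c$ be the unique positive number with $e^{-\lambda_c}(1+e^{-c\lambda_c})=1$; put $\mathsf{s}=e^{-\lambda}$, $a=\big(\sqrt{\mathsf{s}(1-\mathsf{s}^{c+1})}-\sqrt{\mathsf{s}^{c+1}(1-\mathsf{s})}\big)^2$, $b=\big(\sqrt{\mathsf{s}(1-\mathsf{s}^{c+1})}+\sqrt{\mathsf{s}^{c+1}(1-\mathsf{s})}\big)^2$, and $\rho^{(c)}(x)=\frac{2}{\pi\lambda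 x}\arctan\Big(\frac{\sqrt{(x-a)(b-x)}}{(\sqrt{1-x}+\sqrt{1-a})(\sqrt{1-x}+\sqrt{1-b})}\Big)\mathbf{1}_{(a,b)}(x)$ if $\lambda\le\lambda_c$, and $\rho^{(c)}(x)=\frac{2}{\pi\lambda x}\arctan\Big(\sqrt{\frac{x-a}{b-x}}\frac{\sqrt{1-x}+\sqrt{1-b}}{\sqrt{1-x}+\sqrt{1-a}}\Big)\mathbf{1}_{(a,b)}(x)+\frac{1}{\lambda x}\mathbf{1}_{(b,1)}(x)$ if $\lambda>\lambda_c$. *)

(* Defs.v *)
From HB Require Import structures.
From mathcomp Require Import all_boot all_order all_algebra.
From mathcomp Require Import all_classical all_reals all_analysis.
Set Implicit Arguments. Unset Strict Implicit. Unset Printing Implicit Defensive.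
Import Order.TTheory GRing.Theory Num.Theory.
Import numFieldNormedType.Exports.
Local Open Scope classical_set_scope.
Local Open Scope ring_scope.

(* Pairs (p_n, p_{n+1}) of little q-Laguerre polynomials p_n(x; a | q). *)
Fixpoint lqL_pair {R : realType} (a q : R) (n : nat) : {poly R} * {poly R} :=
  match n with
  | 0 => (1, 1 - (1 - a * q)^-1 *: 'X)
  | m.+1 =>
      let pp := lqL_pair a q m in
      let m1 := m.+1 in
      let A := q ^+ m1 * (1 - a * q ^+ m1.+1) in
      let C := a * q ^+ m1 * (1 - q ^+ m1) in
      (pp.2, A^-1 *: ((A + C)%:P * pp.2 - 'X * pp.2 - C%:P * pp.1))
  end.

Definition little_qLaguerre {R : realType} (a q : R) (n : nat) : {poly R} :=
  (lqL_pair a q n).1.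

Definition zero_counting_integral {R : realType} (n : nat) (p : {poly R})
  (f : R -> R) : R :=
  n%:R^-1 * \sum_(x \in [set x : R | root p x]) ((mup x p)%:R * f x).

(* lambda_c : the unique positive l with e^{-l}(1 + e^{-c l}) = 1 *)
Definition lambda_crit {R : realType} (c : R) : R :=
  xget 0 [set l : R | 0 < l /\ expR (- l) * (1 + expR (- (c * l))) = 1].

Definition qMP_a {R : realType} (c lam : R) : R :=
  let s := expR (- lam) in
  (Num.sqrt (s * (1 - s `^ (c + 1))) - Num.sqrt (s `^ (c + 1) * (1 - s))) ^+ 2.

Definition qMP_b {R : realType} (c lam : R) : R :=
  let s := expR (- lam) in
  (Num.sqrt (s * (1 - s `^ (c + 1))) + Num.sqrt (s `^ (c + 1) * (1 - s))) ^+ 2.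

Definition qMP_density {R : realType} (c lam : R) (x : R) : R :=
  let a := qMP_a c lam in
  let b := qMP_b c lam in
  if lam <= lambda_crit c then
    (if (a < x) && (x < b) then
       2 / (pi * lam * x) *
       atan (Num.sqrt ((x - a) * (b - x)) /
             ((Num.sqrt (1 - x) + Num.sqrt (1 - a)) *
              (Num.sqrt (1 - x) + Num.sqrt (1 - b))))
     else 0)
  else
    (if (a < x) && (x < b) then
       2 / (pi * lam * x) *
       atan (Num.sqrt ((x - a) / (b - x)) *
             ((Num.sqrt (1 - x) + Num.sqrt (1 - b)) /
              (Num.sqrt (1 - x) + Num.sqrt (1 - a))))
     else 0)
    + (if (b < x) && (x < 1) then (lam * x)^-1 else 0).

(* Main.v *)
Require Import Defs.
From HB Require Import structures.
From mathcomp Require Import all_boot all_order all_algebra.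
From mathcomp Require Import all_classical all_reals all_analysis.
From mathcomp Require Import measurable_realfun ring lra.
Import Order.TTheory GRing.Theory Num.Theory.
Import numFieldNormedType.Exports.
Local Open Scope classical_set_scope.
Local Open Scope ring_scope.

(* Interlacing puts the [n] zeros [x_j] of [p = p_n] in (0, 1), and [p] satisfies the
   q-difference equation [a p(qx) + (1 - x) p(x/q) = (a + 1 - x q^-n) p(x)].  At [x = -z]
   with [z > 0] both ratios [p(-z)/p(-qz)] and [p(-z/q)/p(-z)] are close to
   [E = exp (lam z G_n(z))], where [G_n] is the mean of [1/(x_j + z)].  With [g = e^(-lam c)]
   and [s = e^(-lam)] this gives [g/E + (1 + z) E -> 1 + g + z/s], whose left side is
   strictly increasing on [E >= 1]; hence [G_n(z)] converges to [ln E / (lam z)].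
   On (0, 1), away from its right edge [b], the density is [acos(Y)/(pi lam x)] with
   [Y = (1 + g - x/s) / (2 sqrt (g (1 - x)))] clipped to [-1, 1].  Writing both [acos Y] and
   [ln E] as integrals over [1 < v < 1/s] and exchanging the integrals over [x] and [v]
   identifies the limit of [G_n(z)] with the integral of [density / (x + z)].  Finally the
   functions [1/(x + z)] span a dense subspace of the continuous functions on [0, 1]. *)

(** * The q-difference equation *)

Section QLaguerreSeries.
Context {R : realType}.
Implicit Types a q x : R.

(** Working at [x = -z] keeps every factor [1 + z / x_j] positive, so the effect of the q-shifts is
    controlled by inequalities between real exponentials, and no branch of a square root has to be
    chosen. On [E >= 1] the left side of the limit equation has slope at least [z] as a function of
    [ln E]; an approximate solution is therefore close to the exact one. The variable [v] can be
    read as [q^-m] for the degrees [m] between [0] and [n]. For fixed [v] the kernel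
    [v / (pi sqrt D)], with [D] the discriminant [qMP_discr], is the arcsine law of an interval, the
    limiting zero distribution for frozen recurrence coefficients; with [v = exp (lam t)] the
    density is the average of these laws over [0 < t < 1]. Both integrals start at [v = 1] because
    there the angle is [0] and [E = 1]. Writing the density as an angle also merges the two regimes:
    the critical value of [lam] only decides whether the angle is clipped to [0] or to [pi] on
    [(b, 1)]. *)

Definition qpoch_down q x (k : nat) : R := \prod_(i < k) (1 - q ^+ i / x).

Definition qLaguerre_den a q (k : nat) : R :=
  \prod_(i < k) ((1 - a * q ^+ i.+1) * (1 - q ^+ i.+1) / q).

(** In standard notation [(q^-n; q)_k q^k / ((aq; q)_k (q; q)_k)], the coefficient of [x^k] in the
    basic hypergeometric series 2phi1 with parameters [q^-n, 0; aq] and argument [qx]. Here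
    [qpoch_down q x k] is [(1/x; q)_k]. *)
Definition qLaguerre_coef a q (n k : nat) : R :=
  qpoch_down q (q ^+ n) k / qLaguerre_den a q k.

Lemma qpoch_downS q x k : qpoch_down q x k.+1 = qpoch_down q x k * (1 - q ^+ k / x).
Proof. by rewrite /qpoch_down big_ord_recr. Qed.

Lemma qpoch_downSl q x k : q != 0 ->
  qpoch_down q x k.+1 = (1 - x^-1) * qpoch_down q (x / q) k.
Proof.
move=> q0; rewrite /qpoch_down big_ord_recl expr0 div1r; congr (_ * _).
apply: eq_bigr => i _ /=; rewrite /bump /= add1n exprS invf_div.
by rewrite mulrA (mulrC (q ^+ i)).
Qed.

Lemma qLaguerre_denS a q k : qLaguerre_den a q k.+1 =
  qLaguerre_den a q k * ((1 - a * q ^+ k.+1) * (1 - q ^+ k.+1) / q).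
Proof. by rewrite /qLaguerre_den big_ord_recr. Qed.

Variables (a q : R).
Hypotheses (a_gt0 : 0 < a) (a_le1 : a <= 1) (q_gt0 : 0 < q) (q_lt1 : q < 1).

Lemma onemXn_gt0 k : 0 < 1 - q ^+ k.+1.
Proof. by rewrite subr_gt0 exprn_ilt1 // ltW. Qed.

Lemma onemaXn_gt0 k : 0 < 1 - a * q ^+ k.+1.
Proof.
rewrite subr_gt0; apply: le_lt_trans (_ : q ^+ k.+1 < 1); last by rewrite exprn_ilt1 // ltW.
by rewrite ler_piMl // exprn_ge0 // ltW.
Qed.

Lemma qLaguerre_den_neq0 k : qLaguerre_den a q k != 0.
Proof.
apply/prodf_neq0 => i _; rewrite mulf_neq0 ?invr_neq0 ?mulf_neq0 //; apply: lt0r_neq0 => //.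
- exact: onemaXn_gt0.
- exact: onemXn_gt0.
Qed.

(** The hypergeometric term ratio, cleared of denominators. Together with the vanishing beyond
    degree [n] it yields the q-difference equation. *)
Lemma qLaguerre_coefS n k :
  qLaguerre_coef a q n k.+1 * ((1 - a * q ^+ k.+1) * (1 - q ^+ k.+1)) =
  qLaguerre_coef a q n k * (q * (1 - q ^+ k / q ^+ n)).
Proof.
rewrite /qLaguerre_coef qpoch_downS qLaguerre_denS.
have := qLaguerre_den_neq0 k; have := lt0r_neq0 (onemXn_gt0 k).
have := lt0r_neq0 (onemaXn_gt0 k); have := lt0r_neq0 q_gt0.
have := lt0r_neq0 (exprn_gt0 n q_gt0).
move: (q ^+ n) (qpoch_down _ _ _) (qLaguerre_den _ _ _) => X P D X0 q0 e1 e2 D0.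
by field; rewrite X0 q0 e1 e2 D0.
Qed.

Lemma qLaguerre_coef_gt n k : (n < k)%N -> qLaguerre_coef a q n k = 0.
Proof.
move=> nk; rewrite /qLaguerre_coef /qpoch_down (bigD1 (Ordinal nk)) //=.
by rewrite divff ?subrr ?mul0r // lt0r_neq0 // exprn_gt0.
Qed.

Lemma qLaguerre_coef_recurrence n k :
  let A := q ^+ n.+1 * (1 - a * q ^+ n.+2) in
  let C := a * q ^+ n.+1 * (1 - q ^+ n.+1) in
  A * qLaguerre_coef a q n.+2 k =
  (A + C) * qLaguerre_coef a q n.+1 k
  - (if k is k'.+1 then qLaguerre_coef a q n.+1 k' else 0)
  - C * qLaguerre_coef a q n k.
Proof.
move=> A C; rewrite /A /C {A C}.
have q0 := lt0r_neq0 q_gt0.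
set X := q ^+ n.+1.
have X0 : X != 0 by rewrite lt0r_neq0 // exprn_gt0.
have E2 : q ^+ n.+2 = q * X by rewrite exprS.
have E0 : q ^+ n = X / q by rewrite /X exprS mulrAC mulfV // mul1r.
rewrite /qLaguerre_coef E2 E0 -/X.
case: k => [|[|k]].
- by rewrite /qpoch_down /qLaguerre_den !big_ord0; field.
- have e1 := lt0r_neq0 (onemXn_gt0 0); have e2 := lt0r_neq0 (onemaXn_gt0 0).
  rewrite /qpoch_down /qLaguerre_den !big_ord_recr !big_ord0 /= expr0 expr1 in e1 e2 *.
  by field; rewrite X0 q0 e1 e2.
- have D0 := qLaguerre_den_neq0 k.
  have e1 := lt0r_neq0 (onemXn_gt0 k); have e2 := lt0r_neq0 (onemaXn_gt0 k).
  have e3 := lt0r_neq0 (onemXn_gt0 k.+1); have e4 := lt0r_neq0 (onemaXn_gt0 k.+1).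
  (* The three degrees involve symbols with bases [X / q], [X] and [q X]. Peeling first factors off
     the last two leaves the common factor [qpoch_down q (X / q) k] and a rational identity; up to
     two factors are peeled, hence the separate cases [0] and [1]. *)
  have qX : q * X / q = X by rewrite mulrAC mulfV // mul1r.
  rewrite !qLaguerre_denS (qpoch_downSl _ (q * X)) // qX.
  rewrite !(qpoch_downSl _ X) // !qpoch_downS.
  rewrite !(exprS q k.+1) !(exprS q k) in e1 e2 e3 e4 *.
  move: (q ^+ k) (qpoch_down _ _ _) (qLaguerre_den _ _ _) D0 e1 e2 e3 e4 => Y P D D0 e1 e2 e3 e4.
  by field; rewrite X0 q0 e1 e2 e3 e4 D0.
Qed.

Lemma little_qLaguerre_recurrence n :
  let A := q ^+ n.+1 * (1 - a * q ^+ n.+2) in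
  let C := a * q ^+ n.+1 * (1 - q ^+ n.+1) in
  little_qLaguerre a q n.+2 = A^-1 *: ((A + C)%:P * little_qLaguerre a q n.+1
    - 'X * little_qLaguerre a q n.+1 - C%:P * little_qLaguerre a q n).
Proof. by []. Qed.

Lemma coef_little_qLaguerre n k : (little_qLaguerre a q n)`_k = qLaguerre_coef a q n k.
Proof.
suff : (forall k, (little_qLaguerre a q n)`_k = qLaguerre_coef a q n k) /\
       (forall k, (little_qLaguerre a q n.+1)`_k = qLaguerre_coef a q n.+1 k).
  by case.
elim: n {k} => [|n [IH0 IH1]]; split => k //.
- rewrite /little_qLaguerre /= coef1; case: k => [|k]; last by rewrite qLaguerre_coef_gt.
  by rewrite /qLaguerre_coef /qpoch_down /qLaguerre_den !big_ord0 divr1.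
- rewrite /little_qLaguerre /= coefB coef1 coefZ coefX.
  case: k => [|[|k]]; last by rewrite qLaguerre_coef_gt //= mulr0 subr0.
    by rewrite /qLaguerre_coef /qpoch_down /qLaguerre_den !big_ord0 divr1 mulr0 subr0.
  have e1 := lt0r_neq0 (onemXn_gt0 0); have e2 := lt0r_neq0 (onemaXn_gt0 0).
  have q0 := lt0r_neq0 q_gt0.
  rewrite /qLaguerre_coef /qpoch_down /qLaguerre_den !big_ord_recr !big_ord0 /=.
  rewrite expr0 expr1 in e1 e2 *.
  by field; rewrite q0 e1 e2.
- rewrite little_qLaguerre_recurrence.
  have := qLaguerre_coef_recurrence n k => /=.
  set A := (q ^+ n.+1 * _); set C := (a * _ * _).
  have A0 : A != 0.
    rewrite /A mulf_neq0 ?lt0r_neq0 ?exprn_gt0 //; exact: onemaXn_gt0.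
  rewrite coefZ !coefB !coefCM coefXM IH0 IH1 => E.
  apply: (mulfI A0); rewrite E mulrA mulfV // mul1r; congr (_ - _ - _).
  by case: k {E} => [|k] //=; rewrite IH1.
Qed.

Lemma size_little_qLaguerre n : (size (little_qLaguerre a q n) <= n.+1)%N.
Proof. by apply/leq_sizeP => j nj; rewrite coef_little_qLaguerre qLaguerre_coef_gt. Qed.

Lemma little_qLaguerre_at0 n : (little_qLaguerre a q n).[0] = 1.
Proof.
rewrite horner_coef0 coef_little_qLaguerre.
by rewrite /qLaguerre_coef /qpoch_down /qLaguerre_den !big_ord0 divr1.
Qed.

Lemma little_qLaguerre_qdifference n x :
  let p := little_qLaguerre a q n in
  a * p.[q * x] + (1 - x) * p.[x / q] = (a + 1 - x / q ^+ n) * p.[x].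
Proof.
move=> p; rewrite /p.
have hE y : (little_qLaguerre a q n).[y] = \sum_(k < n.+1) qLaguerre_coef a q n k * y ^+ k.
  rewrite (horner_coef_wide _ (size_little_qLaguerre n)).
  by apply: eq_bigr => k _; rewrite coef_little_qLaguerre.
rewrite !hE.
(* The operator [a p(qx) + p(x/q) - (a + 1) p(x)] multiplies [x^k] by [(1 - q^k)(1 - a q^k) / q^k],
   which gives [F k]; by the term ratio, the terms carrying an extra [x] give [- F k.+1]. The sums
   cancel because [F 0 = F n.+1 = 0]. *)
pose F k := qLaguerre_coef a q n k * x ^+ k * ((1 - q ^+ k) * (1 - a * q ^+ k) / q ^+ k).
have L : \sum_(k < n.+1) F k = \sum_(k < n.+1) F k.+1.
  rewrite big_ord_recl [RHS]big_ord_recr /=.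
  by rewrite {1 4}/F (qLaguerre_coef_gt n n.+1) // expr0 subrr !mul0r mulr0 add0r addr0.
apply/eqP; rewrite -subr_eq0 !mulr_sumr -big_split -sumrB /=.
move/eqP: L; rewrite -subr_eq0 -sumrB => /eqP L; apply/eqP; rewrite -[RHS]L.
apply: eq_bigr => k _.
have -> : F k.+1 = qLaguerre_coef a q n k * (q * (1 - q ^+ k / q ^+ n)) *
    (x ^+ k.+1 / q ^+ k.+1).
  by rewrite -qLaguerre_coefS /F; ring.
rewrite /F !exprMn exprVn !exprS.
have q0 := lt0r_neq0 q_gt0.
have := expf_neq0 k q0; have := expf_neq0 n q0.
move: (q ^+ n) (q ^+ k) (x ^+ k) (qLaguerre_coef _ _ _ _) => X Y Z W X0 Y0.
by field; rewrite X0 Y0 q0.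
Qed.

(** At [x = 1] the three-term recurrence is satisfied by the solution of a first-order one with
    negative ratio. The resulting alternating sign of [p_n(1)] serves as the right endpoint of the
    interlacing argument. *)
Lemma little_qLaguerre_at1S n : (little_qLaguerre a q n.+1).[1] =
  - (a * q ^+ n.+1 / (1 - a * q ^+ n.+1)) * (little_qLaguerre a q n).[1].
Proof.
have e1 k := lt0r_neq0 (onemaXn_gt0 k).
elim: n => [|n IH].
  rewrite /little_qLaguerre /= !hornerE; have := e1 0%N; rewrite expr1 => e.
  by field.
have q0 := lt0r_neq0 q_gt0.
have X0 : q ^+ n.+1 != 0 by rewrite expf_neq0.
have E : (little_qLaguerre a q n).[1] =
    - ((1 - a * q ^+ n.+1) / (a * q ^+ n.+1)) * (little_qLaguerre a q n.+1).[1].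
  rewrite IH; move: (e1 n) X0 => {}e1 X0; field; rewrite e1 X0; by rewrite lt0r_neq0.
rewrite little_qLaguerre_recurrence !(exprS q n.+1); move: (e1 n) (e1 n.+1) X0 E; rewrite !(exprS q n.+1).
move: (q ^+ n.+1) => X e2 e3 X0 E; rewrite hornerZ !hornerE E.
by rewrite mulrA in e3; field; rewrite X0 e3 lt0r_neq0.
Qed.

Lemma little_qLaguerre_at1_sign n : 0 < (-1) ^+ n * (little_qLaguerre a q n).[1].
Proof.
elim: n => [|n IH]; first by rewrite /little_qLaguerre /= !hornerE ltr01.
rewrite little_qLaguerre_at1S exprS mulN1r [X in _ * X]mulNr mulrNN mulrCA.
by rewrite mulr_gt0 // divr_gt0 ?onemaXn_gt0 // mulr_gt0 // exprn_gt0.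
Qed.

End QLaguerreSeries.

(** * Zeros *)

Section Zeros.
Context {R : realType}.
Implicit Types (p : {poly R}) (s : seq R).

(** Normalized to the value [1] at [0], as [p_n] is, instead of being monic; the leading coefficient
    of [p_n] then never enters. *)
Definition prod_onem s : {poly R} := \prod_(r <- s) (1 - r^-1 *: 'X).

Lemma horner_prod_onem s x :
  (prod_onem s).[x] = \prod_(r <- s) (1 - x / r).
Proof.
by rewrite /prod_onem horner_prod; apply: eq_bigr => r _; rewrite !hornerE mulrC.
Qed.

Lemma size_prod_onem s : (size (prod_onem s) <= (size s).+1)%N.
Proof.
rewrite /prod_onem; elim: s => [|r s IH]; first by rewrite big_nil size_poly1.
rewrite big_cons; apply: leq_trans (size_polyMleq _ _) _ => /=.
have : (size (1 - r^-1 *: 'X : {poly R})%R <= 2)%N.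
  apply: leq_trans (size_polyD _ _) _; rewrite size_polyN geq_max size_poly1 /=.
  by apply: leq_trans (size_scale_leq _ _) _; rewrite size_polyX.
by move=> hf; rewrite -subn1 leq_subLR add1n; exact: leq_add hf IH.
Qed.

(** The difference has degree at most [size s] but vanishes at [0] as well as on [s], one point too
    many. *)
Lemma poly_eq_prod_onem p s : (size p <= (size s).+1)%N -> uniq s ->
  0 \notin s -> all (root p) s -> p.[0] = 1 -> p = prod_onem s.
Proof.
move=> sz us s0 rs p0; apply/eqP; rewrite -subr_eq0; apply/negPn/negP => D0.
have /(max_poly_roots D0) : all (root (p - prod_onem s)) (0 :: s).
  apply/allP => x; rewrite inE => /orP[/eqP ->|xs].
    rewrite rootE hornerD hornerN p0 horner_prod_onem big1 ?subrr // => r _.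
    by rewrite mul0r subr0.
  rewrite rootE hornerD hornerN (eqP (allP rs _ xs)) horner_prod_onem.
  rewrite (big_rem _ xs) /= divff ?subrr ?mul0r ?subrr //.
  by apply: contraNneq s0 => <-.
rewrite /= s0 us => /(_ isT); apply/negP; rewrite -leqNgt.
apply: leq_trans (size_polyD _ _) _.
by rewrite size_polyN geq_max sz size_prod_onem.
Qed.

Lemma mup_prod_onem s x : 0 \notin s ->
  mup x (prod_onem s) = count_mem x s.
Proof.
move=> s0.
have -> : prod_onem s =
    (\prod_(r <- s) - r^-1)%:P * \prod_(r <- s) ('X - r%:P).
  rewrite rmorph_prod -big_split /= /prod_onem !big_seq; apply: eq_bigr => r rs.
  rewrite polyCN mulrBr mulNr mul_polyC mulNr opprK -polyCM mulVf ?polyC1 1?addrC //.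
  by apply: contraNneq s0 => <-.
rewrite mupMr ?mu_prod_XsubC // rootC prodf_seq_neq0; apply/allP => r rs /=.
by rewrite oppr_eq0 invr_eq0; apply: contraNneq s0 => <-.
Qed.

Lemma zero_counting_integral_prod_onem n s f : uniq s -> 0 \notin s ->
  zero_counting_integral n (prod_onem s) f = n%:R^-1 * \sum_(x <- s) f x.
Proof.
move=> us s0; rewrite /zero_counting_integral; congr (_ * _).
have -> : [set x | root (prod_onem s) x] = [set` s].
  apply/seteqP; split => x /=.
    rewrite rootE horner_prod_onem prodf_seq_eq0 => /hasP[r rs /=].
    rewrite subr_eq0 => /eqP xr; suff -> : x = r by [].
    have r0 : r != 0 by apply: contraNneq s0 => <-.
    by apply: (mulIf (invr_neq0 r0)); rewrite divff.
  move=> xs; rewrite rootE horner_prod_onem (big_rem _ xs) /= divff ?subrr ?mul0r //.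
  by apply: contraNneq s0 => <-.
rewrite -fsbig_seq // !big_seq; apply: eq_bigr => x xs.
by rewrite mup_prod_onem // count_uniq_mem // xs mul1r.
Qed.

Lemma poly_alternating_roots p m (t : nat -> R) :
  (forall i, (i <= m)%N -> t i < t i.+1) ->
  (forall i, (i <= m.+1)%N -> 0 < (-1) ^+ i * p.[t i]) ->
  exists y : nat -> R, forall i, (i <= m)%N -> [/\ t i < y i, y i < t i.+1 & root p (y i)].
Proof.
move=> tlt tsgn.
suff /choice[y yP] : forall i, exists x, (i <= m)%N -> [/\ t i < x, x < t i.+1 & root p x].
  by exists y.
move=> i; case: (leqP i m) => im; last by exists 0.
have h1 := tsgn i (leqW im); have h2 := tsgn i.+1 im.
(* The sign factor makes the polynomial negative at [t i] and positive at [t i.+1]. *)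
have [||x /andP[tx xt] rx] := @poly_ivt R ((- (-1) ^+ i) *: p) (t i) (t i.+1).
- exact/ltW/tlt.
- rewrite !hornerZ !mulNr oppr_le0 (ltW h1) /=.
  by move: h2; rewrite exprS !mulN1r mulNr => /ltW.
exists x => _.
have {}rx : root p x.
  by rewrite rootZ // oppr_eq0 signr_eq0 in rx.
have px0 := eqP rx.
split => //.
- rewrite lt_neqAle tx andbT; apply: contraTneq h1 => ->.
  by rewrite px0 mulr0 ltxx.
- rewrite lt_neqAle xt andbT; apply: contraTneq h2 => <-.
  by rewrite px0 mulr0 ltxx.
Qed.

Lemma prod_onem_sign (y : nat -> R) n i x : (i <= n)%N ->
  (forall j, (j < n)%N -> 0 < y j) ->
  (forall j, (j < i)%N -> y j < x) -> (forall j, (i <= j < n)%N -> x < y j) ->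
  0 < (-1) ^+ i * \prod_(0 <= j < n) (1 - x / y j).
Proof.
move=> iln y0 yx xy; rewrite (big_cat_nat (n := i)) //= mulrA mulr_gt0 //.
  have -> : (-1) ^+ i * \prod_(0 <= j < i) (1 - x / y j) = \prod_(0 <= j < i) - (1 - x / y j).
    by rewrite !big_mkord prodrN card_ord.
  rewrite big_mkord; apply: prodr_gt0 => j _.
  by rewrite oppr_gt0 subr_lt0 ltr_pdivlMr ?mul1r ?y0 ?yx // (leq_trans _ iln).
rewrite big_nat; apply: prodr_gt0 => j /andP[ij jn].
by rewrite subr_gt0 ltr_pdivrMr ?mul1r ?y0 ?xy // ij.
Qed.

Variables (a q : R).
Hypotheses (a_gt0 : 0 < a) (a_le1 : a <= 1) (q_gt0 : 0 < q) (q_lt1 : q < 1).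
Local Notation P := (little_qLaguerre a q).

Lemma little_qLaguerre_factor n (y : nat -> R) :
  (forall i, (i < n)%N -> 0 < y i < 1) -> (forall i j, (i < j < n)%N -> y i < y j) ->
  (forall i, (i < n)%N -> root (P n) (y i)) ->
  uniq [seq y i | i <- iota 0 n] /\ P n = prod_onem [seq y i | i <- iota 0 n].
Proof.
move=> y01 ylt yroot.
have us : uniq [seq y i | i <- iota 0 n].
  rewrite map_inj_in_uniq ?iota_uniq // => u v; rewrite !mem_iota !add0n /= => un vn yuv.
  case: (ltngtP u v) => // uv; [have := ylt u v|have := ylt v u].
    by rewrite uv vn yuv ltxx => /(_ isT).
  by rewrite uv un yuv ltxx => /(_ isT).
split => //; apply: poly_eq_prod_onem => //.
- by rewrite size_map size_iota size_little_qLaguerre.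
- apply/mapP => -[u]; rewrite mem_iota add0n /= => /y01/andP[+ _] => /[swap] <-.
  by rewrite ltxx.
- by apply/allP => _ /mapP[u + ->]; rewrite mem_iota add0n /= => /yroot.
- exact: little_qLaguerre_at0.
Qed.

(** The induction carries the sign of [p_(n-1)] at the zeros of [p_n]: there the recurrence reduces
    to [p_(n+1) = - (C / A) p_(n-1)] with [C / A > 0], so [p_(n+1)] alternates along [0], the zeros
    of [p_n], and [1]. *)
Lemma little_qLaguerre_interlacing n : exists y : nat -> R,
  [/\ forall i, (i < n)%N -> 0 < y i < 1,
      forall i j, (i < j < n)%N -> y i < y j,
      forall i, (i < n)%N -> root (P n) (y i) &
      forall i, (i < n)%N -> 0 < (-1) ^+ i * (P n.-1).[y i]].
Proof.
elim: n => [|n [y [y01 ylt yroot ysgn]]].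
  by exists (fun=> 0); split => // i j; rewrite ltn0 andbF.
(* The [n + 2] test points: [0], the [n] old zeros, then [1]. *)
pose t i := if i is j.+1 then (if (j < n)%N then y j else 1) else 0.
have tlt i : (i <= n)%N -> t i < t i.+1.
  case: i => [|i] /= iln.
    by case: ifPn => [/y01/andP[]//|_]; exact: ltr01.
  rewrite iln; case: ifPn => [i1n|_]; first by rewrite ylt // ltnSn.
  by case/andP: (y01 i iln).
have tsgn i : (i <= n.+1)%N -> 0 < (-1) ^+ i * (P n.+1).[t i].
  case: i => [_|i] /=; first by rewrite little_qLaguerre_at0 // mulr1 ltr01.
  case: ifPn => [iln _|]; last first.
    rewrite -leqNgt ltnS => ni iln.
    have -> : i = n by apply/eqP; rewrite eqn_leq ni iln.
    exact: little_qLaguerre_at1_sign.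
  have := ysgn _ iln; have := yroot _ iln.
  case: n iln {y01 ylt yroot ysgn t tlt} => // n iln /eqP r0 /=.
  rewrite little_qLaguerre_recurrence hornerZ !(hornerD, hornerN, hornerM, hornerC) r0.
  rewrite !mulr0 subr0 sub0r.
  set A := (q ^+ _ * _); set C := (a * _ * _) => h.
  have -> : (-1) ^+ i.+1 * (A^-1 * - (C * (P n).[y i])) =
    C / A * ((-1) ^+ i * (P n).[y i]) by rewrite exprS; ring.
  apply: mulr_gt0 => //; apply: divr_gt0; repeat apply: mulr_gt0; rewrite ?exprn_gt0 //.
    exact: onemXn_gt0.
  exact: onemaXn_gt0.
have tle i j : (i <= j <= n.+1)%N -> t i <= t j.
  move=> /andP[]; elim: j => [|j IH]; first by rewrite leqn0 => /eqP ->.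
  rewrite leq_eqVlt => /orP[/eqP -> //|ij jn].
  by apply: le_trans (IH _ _) (ltW (tlt _ _)) => //; exact: ltnW.
have [y' y'P] := @poly_alternating_roots (P n.+1) n t tlt tsgn.
exists y'; split.
- move=> i iln; have [h1 h2 _] := y'P i iln.
  apply/andP; split.
    by apply: le_lt_trans h1; apply: (tle 0%N); rewrite leq0n /= ltnW.
  apply: lt_le_trans h2 _; have := tle i.+1 n.+1; rewrite /= ltnn; apply.
  by rewrite ltnS -ltnS iln leqnn.
- move=> i j /andP[ij jn].
  have [_ h2 _] := y'P i (leq_trans (ltnW ij) jn); have [h1 _ _] := y'P j jn.
  apply: lt_trans h2 (le_lt_trans (tle _ _ _) h1); by rewrite ij ltnW.
- by move=> i iln; have [] := y'P i iln.
- move=> i iln /=; have [h1 h2 _] := y'P i iln.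
  (* The new sign condition is read off the factorization of [p_n]: exactly [i] old zeros lie to the
     left of [y' i]. *)
  have [_ ->] := little_qLaguerre_factor n y y01 ylt yroot.
  rewrite horner_prod_onem big_map -[n in iota 0 n]subn0.
  apply: prod_onem_sign => //.
  + by move=> j /y01/andP[].
  + move=> j ji; apply: le_lt_trans h1; have := tle j.+1 i.
    by rewrite /= ji (leq_trans ji iln) (ltnW iln); exact.
  + move=> j /andP[ij jn]; apply: lt_le_trans h2 _; have := tle i.+1 j.+1.
    by rewrite /= jn; apply; rewrite !ltnS ij ltnW.
Qed.

Lemma little_qLaguerre_zeros n : exists s : seq R,
  [/\ size s = n, uniq s, {in s, forall x, 0 < x < 1} &
      P n = prod_onem s].
Proof.
have [y [y01 ylt yroot _]] := little_qLaguerre_interlacing n.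
have [us PE] := little_qLaguerre_factor n y y01 ylt yroot.
exists [seq y i | i <- iota 0 n]; split => //; first by rewrite size_map size_iota.
by move=> _ /mapP[u + ->]; rewrite mem_iota add0n /= => /y01.
Qed.

End Zeros.

(** * Limit of the resolvents *)

Section ResolventBounds.
Context {R : realType}.
Implicit Types (s : seq R).

Lemma prod_le_expR s (F G T : R -> R) :
  {in s, forall x, 0 <= F x <= expR (T x) * G x} ->
  \prod_(x <- s) F x <= expR (\sum_(x <- s) T x) * \prod_(x <- s) G x.
Proof.
move=> FG; rewrite expR_sum -big_split /= !big_seq.
exact: ler_prod.
Qed.

Lemma horner_prod_onemN s (y : R) : (prod_onem s).[- y] = \prod_(x <- s) (1 + y / x).
Proof. by rewrite horner_prod_onem; apply: eq_bigr => x _; rewrite mulNr opprK. Qed.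

(** The ratio [(1 + z/x) / (1 + qz/x)] of one factor equals [1 + (1 - q) z / (x + qz)] and is the
    inverse of [1 - (1 - q) z / (x + z)]. The inequality [1 + u <= exp u] bounds it on both sides,
    and [x + qz >= q (x + z)] expresses the upper bound by the resolvent at [z] too, at the price of
    [t / q]. *)
Lemma prod_onem_ratio_bounds s q z : 0 < q -> q < 1 -> 0 < z ->
  {in s, forall x, 0 < x} ->
  let t := (1 - q) * z * \sum_(x <- s) (x + z)^-1 in
  expR t * (prod_onem s).[- (q * z)] <= (prod_onem s).[- z]
    <= expR (t / q) * (prod_onem s).[- (q * z)] .
Proof.
move=> q0 q1 z0 s0; set t := _ * _ => /=.
rewrite !horner_prod_onemN; apply/andP; split.
  rewrite -ler_pdivlMl ?expR_gt0 // -expRN.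
  have -> : - t = \sum_(x <- s) - ((1 - q) * z * (x + z)^-1).
    by rewrite sumrN /t mulr_sumr.
  apply: prod_le_expR => x /s0 x0.
  have xz : 0 < x + z by rewrite addr_gt0.
  apply/andP; split; first by rewrite addr_ge0 // divr_ge0 ?mulr_ge0 ?ltW.
  have -> : 1 + q * z / x = (1 - (1 - q) * z * (x + z)^-1) * (1 + z / x).
    by field; rewrite !lt0r_neq0.
  rewrite ler_wpM2r ?expR_ge1Dx //.
  by rewrite addr_ge0 // divr_ge0 ?ltW.
have -> : t / q = \sum_(x <- s) ((1 - q) * z * (x + z)^-1 / q).
  by rewrite -mulr_suml /t mulr_sumr.
apply: prod_le_expR => x /s0 x0.
have xz : 0 < x + z by rewrite addr_gt0.
have xqz : 0 < x + q * z by rewrite addr_gt0 // mulr_gt0.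
apply/andP; split; first by rewrite addr_ge0 // divr_ge0 ?ltW.
have -> : 1 + z / x = (1 + (1 - q) * z / (x + q * z)) * (1 + q * z / x).
  by field; rewrite !lt0r_neq0.
rewrite ler_wpM2r //; first by rewrite addr_ge0 // divr_ge0 ?mulr_ge0 ?ltW.
apply: le_trans (expR_ge1Dx _); rewrite lerD2l -!mulrA.
rewrite ler_wpM2l ?subr_ge0 ?(ltW q1) // ler_wpM2l ?(ltW z0) //.
rewrite -invfM lef_pV2 ?posrE ?mulr_gt0 //; nra.
Qed.

(* The q-difference equation at [-z], with the ratios of consecutive values
   squeezed between exponentials of the resolvent. *)
Lemma qLaguerre_resolvent_bounds (a q z : R) n s :
  0 < a -> a <= 1 -> 0 < q -> q < 1 -> 0 < z ->
  {in s, forall x, 0 < x < 1} -> little_qLaguerre a q n = prod_onem s ->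
  let t := (1 - q) * z * \sum_(x <- s) (x + z)^-1 in
  a * expR (- (t / q)) + (1 + z) * expR t <= a + 1 + z / q ^+ n
    <= a * expR (- t) + (1 + z) * expR (t / q).
Proof.
move=> a0 a1 q0 q1 z0 s01 PE; set t := _ * _ => /=.
have s0 : {in s, forall x, 0 < x} by move=> x /s01/andP[].
have := little_qLaguerre_qdifference a q a1 q0 q1 n (- z); rewrite /= PE.
rewrite !(mulrN, mulNr, opprK).
have pos y : 0 < y -> 0 < (prod_onem s).[- y].
  move=> y0; rewrite horner_prod_onem big_seq; apply: prodr_gt0 => x /s0 x0.
  by rewrite mulNr opprK addr_gt0 // divr_gt0.
have /andP[] := prod_onem_ratio_bounds s q z q0 q1 z0 s0; rewrite -/t.
have Pz := pos _ z0; have Pqz := pos _ (mulr_gt0 q0 z0).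
rewrite -ler_pdivlMl ?expR_gt0 // -expRN => h1.
rewrite -ler_pdivrMl ?expR_gt0 // -expRN => h2.
(* Applying the previous bounds at [z / q] would produce the resolvent at [z / q]; the factorwise
   estimate is redone so that the same [t] occurs for both ratios. *)
have [h3 h4] : expR t * (prod_onem s).[- z] <= (prod_onem s).[- (z / q)] /\
    (prod_onem s).[- (z / q)] <= expR (t / q) * (prod_onem s).[- z].
  rewrite !horner_prod_onemN; split.
    rewrite -ler_pdivlMl ?expR_gt0 // -expRN.
    have -> : - t = \sum_(x <- s) - ((1 - q) * z * (x + z)^-1).
      by rewrite sumrN /t mulr_sumr.
    apply: prod_le_expR => x /s0 x0.
    have xz : 0 < x + z by rewrite addr_gt0.
    have xzq : 0 < q * x + z by rewrite addr_gt0 // mulr_gt0.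
    apply/andP; split; first by rewrite addr_ge0 // divr_ge0 ?ltW.
    have -> : 1 + z / x = (1 - (1 - q) * z / (q * x + z)) * (1 + z / q / x).
      by field; rewrite !lt0r_neq0.
    rewrite ler_wpM2r //; first by rewrite addr_ge0 // !divr_ge0 ?ltW.
    apply: le_trans (expR_ge1Dx _); rewrite lerD2l lerN2 -!mulrA.
    rewrite ler_wpM2l ?subr_ge0 ?(ltW q1) // ler_wpM2l ?(ltW z0) //.
    by rewrite lef_pV2 ?posrE // lerD2r ler_piMl // ltW.
  have -> : t / q = \sum_(x <- s) ((1 - q) * z * (x + z)^-1 / q).
    by rewrite -mulr_suml /t mulr_sumr.
  apply: prod_le_expR => x /s0 x0.
  have xz : 0 < x + z by rewrite addr_gt0.
  apply/andP; split; first by rewrite addr_ge0 // !divr_ge0 ?ltW.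
  have -> : 1 + z / q / x = (1 + (1 - q) * z * (x + z)^-1 / q) * (1 + z / x).
    by field; rewrite !lt0r_neq0.
  rewrite ler_wpM2r ?expR_ge1Dx //.
  by rewrite addr_ge0 // divr_ge0 ?ltW.
clearbody t; have z1 : 0 <= 1 + z by rewrite addr_ge0 // ltW.
move=> E; apply/andP; split; rewrite -(ler_pM2r Pz) -E.
  by rewrite [X in X <= _]mulrDl -!mulrA; apply: lerD; apply: ler_wpM2l => //; exact: ltW.
by rewrite [X in _ <= X]mulrDl -!mulrA; apply: lerD; apply: ler_wpM2l => //; exact: ltW.
Qed.

(* The larger root [E] of [g / E + (1 + z) E = 1 + g + z v]. *)
Definition resolvent_root (g z v : R) : R :=
  let B := 1 + g + z * v in
  (B + Num.sqrt (B ^+ 2 - 4 * g * (1 + z))) / (2 * (1 + z)).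

(** The right side increases with [v] and equals the left side at [v = 1]. So the square root in
    [resolvent_root] is at least [1 + z - g > 0]. *)
Lemma resolvent_discr_ge (g z v : R) : 0 < g -> g <= 1 -> 0 < z -> 1 <= v ->
  (1 + z - g) ^+ 2 <= (1 + g + z * v) ^+ 2 - 4 * g * (1 + z).
Proof.
move=> g0 g1 z0 v1.
have h : 1 + g + z <= 1 + g + z * v by rewrite lerD2l ler_pMr.
have h2 : (1 + g + z) ^+ 2 <= (1 + g + z * v) ^+ 2.
  by rewrite lerXn2r // nnegrE; lra.
nra.
Qed.

Lemma resolvent_root_ge1 (g z v : R) : 0 < g -> g <= 1 -> 0 < z -> 1 <= v ->
  1 <= resolvent_root g z v.
Proof.
move=> g0 g1 z0 v1; have := resolvent_discr_ge g z v g0 g1 z0 v1.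
rewrite -ler_sqrt; last by rewrite (le_trans _ (resolvent_discr_ge _ _ _ _ _ _ _)) // sqr_ge0.
rewrite sqrtr_sqr ger0_norm; last by lra.
rewrite /resolvent_root ler_pdivlMr; last by lra.
have : z <= z * v by rewrite ler_pMr.
move: (Num.sqrt _) => D; nra.
Qed.

Lemma resolvent_rootE (g z v : R) : 0 < g -> g <= 1 -> 0 < z -> 1 <= v ->
  let E := resolvent_root g z v in g / E + (1 + z) * E = 1 + g + z * v.
Proof.
move=> g0 g1 z0 v1 E.
have E1 : 1 <= E by exact: resolvent_root_ge1.
have E0 : E != 0 by lra.
suff H : (1 + z) * E ^+ 2 + g = (1 + g + z * v) * E.
  apply: (mulIf E0); rewrite -H mulrDl; field; by [].
have := resolvent_discr_ge g z v g0 g1 z0 v1.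
move=> h; rewrite /E /resolvent_root /=; move: E1 E0 => _ _; clear E.
have : 0 <= (1 + g + z * v) ^+ 2 - 4 * g * (1 + z) by apply: le_trans h; exact: sqr_ge0.
move=> /sqr_sqrtr; set D := Num.sqrt _; set B := 1 + g + z * v => DE.
have -> : (1 + z) * ((B + D) / (2 * (1 + z))) ^+ 2 + g =
   (B ^+ 2 + 2 * B * D + D ^+ 2) / (4 * (1 + z)) + g by field; lra.
rewrite DE; field; lra.
Qed.

(** The derivative [(1 + z) e^t - g e^-t] is at least [1 + z - g >= z] for [t >= 0]. This
    quantitative injectivity converts an error in the equation into an error in its solution. *)
Lemma resolvent_map_expand (g z t u : R) : 0 < g -> g <= 1 -> 0 < z -> 0 <= t -> t <= u ->
  z * (u - t) <= (g * expR (- u) + (1 + z) * expR u) - (g * expR (- t) + (1 + z) * expR t).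
Proof.
move=> g0 g1 z0 t0 tu.
have h1 : u - t <= expR u - expR t.
  have -> : expR u = expR t * expR (u - t) by rewrite -expRD; congr expR; lra.
  have := expR_ge1Dx (u - t); have : 1 <= expR t by rewrite -expR0 ler_expR.
  move: (expR t) (expR (u - t)) => A B; nra.
have h2 : expR (- t) - expR (- u) <= u - t.
  have -> : expR (- u) = expR (- t) * expR (- (u - t)) by rewrite -expRD; congr expR; lra.
  have := expR_ge1Dx (- (u - t)); have : expR (- t) <= 1 by rewrite -expR0 ler_expR; lra.
  have := expR_gt0 (- t).
  have : expR (- (u - t)) <= 1 by rewrite -expR0 ler_expR; lra.
  move: (expR (- t)) (expR (- (u - t))) => A B; nra.
have h3 : 0 <= expR (- t) - expR (- u) by rewrite subr_ge0 ler_expR; lra.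
move: (expR u) (expR t) (expR (- t)) (expR (- u)) h1 h2 h3 => A B C D; nra.
Qed.

End ResolventBounds.

Section ResolventLimit.
Context {R : realType}.

Lemma cvg_dist_le (u e : nat -> R) (l : R) :
  (\forall k \near \oo, `|u k - l| <= e k) -> e k @[k --> \oo] --> (0 : R) ->
  u k @[k --> \oo] --> l.
Proof.
move=> ue e0; apply/cvgrPdistC_lt => eps eps0.
near=> k; apply: le_lt_trans (_ : e k < eps); first by near: k.
near: k; move/cvgr_lt : e0; exact.
Unshelve. all: by end_near. Qed.

(** Here [tau] solves the limit equation and [t] the perturbed inequalities. The four error terms
    come from the right side, from [a] against [g], and from [t / q] against [t] in the decreasing
    and in the increasing exponential. *)
Lemma resolvent_error (a q g z B B' t tau M : R) :
  0 < a -> a <= 1 -> 0 < q -> q < 1 -> 0 < g -> g <= 1 -> 0 < z ->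
  0 <= t -> t <= M -> 0 <= tau ->
  g * expR (- tau) + (1 + z) * expR tau = B ->
  a * expR (- (t / q)) + (1 + z) * expR t <= B' ->
  B' <= a * expR (- t) + (1 + z) * expR (t / q) ->
  z * `|t - tau| <= `|B' - B| + `|g - a| + M * (q^-1 - 1) +
    (1 + z) * expR M * (expR (M * (q^-1 - 1)) - 1).
Proof.
move=> a0 a1 q0 q1 g0 g1 z0 t0 tM tau0 BE h1 h2.
set d := q^-1 - 1.
have d0 : 0 <= d by rewrite subr_ge0 invf_ge1 // ltW.
have tq : t / q = t + t * d by rewrite /d; field; rewrite lt0r_neq0.
have td : t * d <= M * d by rewrite ler_wpM2r.
have M0 : 0 <= M by exact: le_trans tM.
have e1 : expR (- t) <= 1 by rewrite -expR0 ler_expR oppr_le0.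
have e1' := expR_gt0 (- t).
have ed1 : 1 <= expR (M * d) by rewrite -expR0 ler_expR mulr_ge0.
have eM1 : 1 <= expR M by rewrite -expR0 ler_expR.
have e2 : expR (- t) - expR (- (t / q)) <= M * d.
  rewrite tq opprD expRD; have := expR_ge1Dx (- (t * d)).
  have : expR (- (t * d)) <= 1 by rewrite -expR0 ler_expR oppr_le0 mulr_ge0.
  move: (expR (- t)) (expR (- (t * d))) e1 e1' => A C; nra.
have e3 : 0 <= expR (- t) - expR (- (t / q)).
  rewrite subr_ge0 ler_expR lerN2 tq; have := mulr_ge0 t0 d0; lra.
have e4 : expR (t / q) - expR t <= expR M * (expR (M * d) - 1).
  rewrite tq expRD; have : expR t <= expR M by rewrite ler_expR.
  have : expR (t * d) <= expR (M * d) by rewrite ler_expR.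
  have : 1 <= expR (t * d) by rewrite -expR0 ler_expR mulr_ge0.
  have := expR_gt0 t.
  move: (expR t) (expR (t * d)) (expR M) (expR (M * d)) => A C D E *; nra.
have n1 : `|(g - a) * expR (- t)| <= `|g - a|.
  by rewrite normrM [X in _ * X]ger0_norm ?(ltW e1') // ler_piMr.
have n2 := ler_norm ((g - a) * expR (- t)).
have n3 := ler_norm (- ((g - a) * expR (- t))); rewrite normrN in n3.
have n4 : 0 <= M * d by rewrite mulr_ge0.
have n5 : 0 <= (1 + z) * expR M * (expR (M * d) - 1).
  by rewrite mulr_ge0 ?subr_ge0 // mulr_ge0 ?expR_ge0 // addr_ge0 // ltW.
have n6 : a * (expR (- t) - expR (- (t / q))) <= M * d.
  by apply: le_trans e2; rewrite ler_piMl.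
have n7 : (1 + z) * (expR (t / q) - expR t) <= (1 + z) * expR M * (expR (M * d) - 1).
  by rewrite -mulrA ler_wpM2l // addr_ge0 // ltW.
have [tt|tt] := leP tau t.
  have := resolvent_map_expand g z tau t g0 g1 z0 tau0 tt.
  rewrite BE => h; rewrite ger0_norm ?subr_ge0 //; apply: le_trans h _.
  have := ler_norm (B' - B); lra.
have := resolvent_map_expand g z t tau g0 g1 z0 t0 (ltW tt).
rewrite BE => h; rewrite distrC ger0_norm ?subr_ge0 ?(ltW tt) //; apply: le_trans h _.
have := ler_norm (- (B' - B)); rewrite normrN; lra.
Qed.

(** The counting integral is [t / ((1 - q) n z)], where [t] solves the limit equation up to
    vanishing errors. *)
Lemma zero_counting_resolvent_cvg (a q : nat -> R) (n : nat -> nat) (g lam s z : R) :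
  (forall k, 0 < a k <= 1) -> (forall k, 0 < q k < 1) ->
  0 < g -> g <= 1 -> 0 < lam -> 0 < s -> s <= 1 -> 0 < z ->
  (\forall k \near \oo, (0 < n k)%N) ->
  a k @[k --> \oo] --> g -> q k @[k --> \oo] --> (1 : R) ->
  q k ^+ n k @[k --> \oo] --> s ->
  (1 - q k) * (n k)%:R @[k --> \oo] --> lam ->
  zero_counting_integral (n k) (little_qLaguerre (a k) (q k) (n k)) (fun x => (x + z)^-1)
    @[k --> \oo] --> ln (resolvent_root g z s^-1) / (lam * z).
Proof.
move=> a01 q01 g0 g1 lam0 s0 s1 z0 npos ag q1 qs qn.
have /choice[r rP] : forall k, exists r, [/\ size r = n k, uniq r,
    {in r, forall x, 0 < x < 1} & little_qLaguerre (a k) (q k) (n k) = prod_onem r].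
  move=> k; have /andP[? ?] := a01 k; have /andP[? ?] := q01 k.
  exact: little_qLaguerre_zeros.
pose t k := (1 - q k) * z * \sum_(x <- r k) (x + z)^-1.
set tau := ln _.
have v1 : 1 <= s^-1 by rewrite invf_ge1.
have E1 := resolvent_root_ge1 g z s^-1 g0 g1 z0 v1.
have tau0 : 0 <= tau by rewrite ln_ge0.
have tauE : g * expR (- tau) + (1 + z) * expR tau = 1 + g + z * s^-1.
  rewrite expRN /tau lnK ?posrE; last by exact: lt_le_trans E1.
  exact: resolvent_rootE.
have t0 k : 0 <= t k.
  have /andP[q0 /ltW qk1] := q01 k; have [_ _ r01 _] := rP k.
  rewrite !mulr_ge0 ?subr_ge0 ?(ltW z0) // big_seq sumr_ge0 // => x /r01/andP[x0 _].
  by rewrite invr_ge0 addr_ge0 // ltW.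
have tM k : t k <= (1 - q k) * (n k)%:R.
  have /andP[q0 /ltW qk1] := q01 k; have [szr _ r01 _] := rP k.
  rewrite /t -mulrA ler_wpM2l ?subr_ge0 // mulr_sumr.
  apply: le_trans (_ : \sum_(x <- r k) 1 <= _); last first.
    by rewrite big_const_seq count_predT szr iter_addr_0.
  rewrite !big_seq; apply: ler_sum => x /r01/andP[x0 _].
  by rewrite ler_pdivrMr ?mul1r ?addr_gt0 // lerDr ltW.
have tcvg : t k @[k --> \oo] --> tau.
  (* [t k] is bounded by [(1 - q k) n k], which tends to [lam]; so [lam + 1] eventually bounds
     [t k]. *)
  pose M := lam + 1.
  pose e k := z^-1 * (`|(a k + 1 + z / q k ^+ n k) - (1 + g + z * s^-1)| + `|g - a k| +
    M * ((q k)^-1 - 1) + (1 + z) * expR M * (expR (M * ((q k)^-1 - 1)) - 1)).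
  apply: (@cvg_dist_le _ e).
    near=> k.
    have /andP[a0 a1] := a01 k; have /andP[q0 qk1] := q01 k; have [szr _ r01 PE] := rP k.
    rewrite /e ler_pdivlMl //.
    have /andP[b1 b2] := qLaguerre_resolvent_bounds (a k) (q k) z (n k) (r k) a0 a1 q0 qk1 z0 r01 PE.
    apply: (resolvent_error (a k) (q k) g z _ _ (t k) tau M _ _ _ _ _ _ _ _ _ _ tauE b1 b2) => //.
    apply: le_trans (tM k) _; near: k; move/cvgr_le : qn; apply; rewrite /M; lra.
  have d0 : (q k)^-1 - 1 @[k --> \oo] --> (0 : R).
    rewrite -(subrr (1 : R)); apply: cvgB; last exact: cvg_cst.
    by rewrite -[X in _ --> X]invr1; apply: cvgV => //; exact: oner_neq0.
  rewrite -(mulr0 z^-1); apply: cvgMl_tmp.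
  rewrite (_ : 0 = 0 + 0 + M * 0 + (1 + z) * expR M * (expR (M * 0) - 1)); last first.
    by rewrite !mulr0 expR0 subrr mulr0 !addr0.
  apply: cvgD; [apply: cvgD; [apply: cvgD|]|].
  + rewrite -(normr0 R); apply: cvg_norm.
    rewrite -(subrr (1 + g + z * s^-1)); apply: cvgB; last exact: cvg_cst.
    apply: cvgD; first by rewrite addrC; apply: cvgD => //; exact: cvg_cst.
    by apply: cvgMl_tmp; apply: cvgV => //; exact: lt0r_neq0.
  + rewrite -(normr0 R); apply: cvg_norm.
    by rewrite -(subrr g); apply: cvgB => //; exact: cvg_cst.
  + exact: cvgMl_tmp.
  + apply: cvgMl_tmp; apply: cvgB; last exact: cvg_cst.
    apply: continuous_cvg; first exact: continuous_expR.
    exact: cvgMl_tmp.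
apply: (@cvg_trans _ (t k / ((1 - q k) * (n k)%:R * z) @[k --> \oo])); last first.
  apply: cvgM => //; apply: cvgV; first by rewrite mulf_neq0 ?lt0r_neq0.
  by apply: cvgMr_tmp.
apply: near_eq_cvg; near=> k.
have /andP[q0 qk1] := q01 k; have [szr ur r01 PE] := rP k.
have nk : (0 < n k)%N by near: k.
rewrite PE zero_counting_integral_prod_onem //; last first.
  by apply/negP => /r01; rewrite ltxx.
rewrite /t; field; rewrite !lt0r_neq0 ?ltr0n ?subr_gt0 //.
Unshelve. all: by end_near. Qed.

End ResolventLimit.

(** * The density as an inverse cosine *)

Section Density.
Context {R : realType}.

Definition clip (y : R) : R := Num.max (-1) (Num.min 1 y).

Definition qMP_cos (g v x : R) : R := (1 + g - x * v) / (2 * Num.sqrt (g * (1 - x))).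

(** A cosine above [1] gives the angle [0] (no mass); one below [-1] gives [pi], which after
    division by [pi lam x] is the saturated density [1 / (lam x)]. *)
Definition qMP_angle (g v x : R) : R := acos (clip (qMP_cos g v x)).

Lemma clip_itv y : -1 <= clip y <= 1.
Proof. by rewrite /clip le_max lexx /= ge_max ge_min lexx /= andbT; lra. Qed.

Lemma clip_id y : -1 <= y <= 1 -> clip y = y.
Proof. by move=> /andP[h1 h2]; rewrite /clip min_r // max_r. Qed.

Lemma acos_clip_ge1 y : 1 <= y -> acos (clip y) = 0.
Proof. by move=> h; rewrite /clip min_l // max_r ?acos1 //; lra. Qed.

Lemma acos_clip_leN1 y : y <= -1 -> acos (clip y) = pi.
Proof.
move=> h; rewrite /clip min_r ?max_l ?acosN1 //; apply: (le_trans h); lra.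
Qed.

(** [T] is the tangent of the half angle: its square is [(1 - cos) / (1 + cos)]. *)
Lemma acos_half_angle (y T : R) : 0 <= T -> -1 < y < 1 -> T ^+ 2 * (1 + y) = 1 - y ->
  acos y = 2 * atan T.
Proof.
move=> T0 /andP[y1 y2] TE.
have -> : y = cos (2 * atan T).
  rewrite mulr_natl cos_mulr2n cos_atan exprVn sqr_sqrtr ?addr_ge0 ?sqr_ge0 //.
  have : 1 + T ^+ 2 != 0 by rewrite lt0r_neq0 // ltr_wpDr ?sqr_ge0.
  move: (T ^+ 2) TE => S SE S0; have -> : S = (1 - y) / (1 + y) by rewrite -SE; field; lra.
  rewrite mulr2n; field; lra.
rewrite cosK // in_itv /=; have := atan_ltpi2 T.
have : 0 <= atan T by rewrite -(atan0 R) le_atan.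
lra.
Qed.

(** The function [phi] decreases strictly from [2] at [0] to at most [2 / e <= 1] at [1]. Hence the
    root exists, [xget] does not return its default, and comparing [lam] with the root is comparing
    [phi lam] with [1]. *)
Lemma lambda_critP (c lam : R) : 0 <= c -> 0 < lam ->
  (lam <= lambda_crit c) = (1 <= expR (- lam) * (1 + expR (- (lam * c)))).
Proof.
move=> c0 lam0.
pose phi (l : R) := expR (- l) * (1 + expR (- (c * l))).
have phi_lt l l' : l < l' -> phi l' < phi l.
  move=> ll; rewrite /phi.
  apply: (@lt_le_trans _ _ (expR (- l) * (1 + expR (- (c * l'))))).
    by rewrite ltr_pM2r ?ltr_expR ?ltrN2 // ltr_pwDl // expR_ge0.
  by rewrite ler_pM2l ?expR_gt0 // lerD2l ler_expR lerN2 ler_wpM2l // ltW.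
have [l [l0 l1]] : exists l, 0 < l /\ phi l = 1.
  have cphi : {within `[0, 1], continuous phi}.
    apply: continuous_subspaceT => x; apply: cvgM.
      apply: continuous_comp; last exact: continuous_expR.
      exact: opp_continuous.
    apply: cvgD; first exact: cvg_cst.
    apply: continuous_comp; last exact: continuous_expR.
    by apply: cvgN; apply: cvgMl_tmp.
  have p0 : phi 0 = 2 by rewrite /phi mulr0 oppr0 expR0 mul1r.
  have p1 : phi 1 <= 1.
    rewrite /phi mulr1 expRN mulrC ler_pdivrMr ?expR_gt0 // mul1r.
    apply: le_trans (expR_ge1Dx 1); rewrite lerD2l -expR0 ler_expR; lra.
  have [|l lin phil] := @IVT R phi 0 1 1 ler01 cphi.
    rewrite p0; apply/andP; split.
      by rewrite ge_min p1 orbT.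
    by rewrite le_max ler1n.
  exists l; split => //; move: lin; rewrite in_itv /= => /andP[].
  rewrite le_eqVlt => /orP[/eqP l0|//]; move: phil; rewrite -l0 p0; lra.
rewrite /lambda_crit; case: xgetP => [m _ [m0 mE]|/(_ l)[]//].
rewrite (mulrC lam c) -/(phi lam) -mE -/(phi m).
apply/idP/idP => [|h].
  by rewrite le_eqVlt => /orP[/eqP -> //|/phi_lt/ltW].
by rewrite leNgt; apply/negP => /phi_lt; rewrite ltNge h.
Qed.

(* With [w = sqrt (1 - x)], [m = s sqrt g] and [l = sqrt ((1 - s) (1 - s g))], the value
   [qMP_cos g s^-1 x] is the cosine of the angle between the sides [w] and [m] of a triangle
   with third side [l]. *)
Local Notation Y w m l := ((w ^+ 2 + m ^+ 2 - l ^+ 2) / (2 * m * w)).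

Lemma triangle_cos_ge1 (w m l : R) : 0 < w -> 0 < m -> 0 <= l ->
  (w <= m - l) || (m + l <= w) -> 1 <= Y w m l.
Proof.
move=> w0 m0 l0 h; rewrite ler_pdivlMr ?mulr_gt0 //.
case/orP: h => h.
  have : 0 <= (m - w - l) * (m - w + l) by apply: mulr_ge0; lra.
  lra.
have : 0 <= (w - m - l) * (w - m + l) by apply: mulr_ge0; lra.
lra.
Qed.

Lemma triangle_cos_leN1 (w m l : R) : 0 < w -> 0 < m -> 0 <= l ->
  w <= l - m -> Y w m l <= -1.
Proof.
move=> w0 m0 l0 h; rewrite ler_pdivrMr ?mulr_gt0 //.
have : 0 <= (l - m - w) * (l + m + w) by apply: mulr_ge0; lra.
lra.
Qed.

Lemma triangle_cos_itv (w m l : R) : 0 < w -> 0 < m -> 0 <= l ->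
  w < m + l -> m - l < w -> l - m < w -> -1 < Y w m l < 1.
Proof.
move=> w0 m0 l0 h1 h2 h3; apply/andP; split.
  rewrite ltr_pdivlMr ?mulr_gt0 //.
  have : 0 < (w + m - l) * (w + m + l) by apply: mulr_gt0; lra.
  lra.
rewrite ltr_pdivrMr ?mulr_gt0 //.
have : 0 < (l - (w - m)) * (l + (w - m)) by apply: mulr_gt0; lra.
lra.
Qed.

(** The squared half-angle tangent is [(m + l - w)(w - m + l) / ((w + m + l)(w + m - l))]. It is
    grouped so that [sqrt (1 - b)] appears as [m - l] here and as [l - m] in [triangle_acos_sup],
    matching the two formulas for the density. *)
Lemma triangle_acos_sub (w m l : R) : 0 < w -> 0 < m -> 0 <= l ->
  w < m + l -> m - l < w -> l <= m ->
  acos (Y w m l) = 2 * atan (Num.sqrt (((m + l) ^+ 2 - w ^+ 2) * (w ^+ 2 - (m - l) ^+ 2)) /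
    ((w + (m + l)) * (w + (m - l)))).
Proof.
move=> w0 m0 l0 h1 h2 h3; apply: acos_half_angle.
- by rewrite divr_ge0 ?sqrtr_ge0 // mulr_ge0 //; lra.
- by apply: triangle_cos_itv => //; lra.
- rewrite expr_div_n sqr_sqrtr; last by apply: mulr_ge0; nra.
  field; by rewrite !lt0r_neq0 //; lra.
Qed.

Lemma triangle_acos_sup (w m l : R) : 0 < w -> 0 < m -> 0 <= l ->
  w < m + l -> l - m < w -> m < l ->
  acos (Y w m l) = 2 * atan (Num.sqrt (((m + l) ^+ 2 - w ^+ 2) / (w ^+ 2 - (l - m) ^+ 2)) *
    ((w + (l - m)) / (w + (m + l)))).
Proof.
move=> w0 m0 l0 h1 h2 h3.
have k1 : 0 < w ^+ 2 - (l - m) ^+ 2 by nra.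
have k2 : 0 < (m + l) ^+ 2 - w ^+ 2 by nra.
apply: acos_half_angle.
- by rewrite mulr_ge0 ?sqrtr_ge0 // divr_ge0 //; lra.
- by apply: triangle_cos_itv => //; lra.
- rewrite exprMn sqr_sqrtr; last by rewrite divr_ge0 ?ltW.
  field; by rewrite !lt0r_neq0 //; lra.
Qed.


(** Since [1 - a = (m + l)^2] and [1 - b = (m - l)^2], the condition [a < x < b] is the strict
    triangle inequality. The point [b] is excluded because above the critical value both strict
    indicators vanish there while the angle is [pi]. *)
Lemma qMP_densityE (c lam x : R) : 0 <= c -> 0 < lam -> 0 < x -> x < 1 ->
  x != qMP_b c lam ->
  qMP_density c lam x = qMP_angle (expR (- (lam * c))) (expR lam) x / (pi * lam * x).
Proof.
move=> c0 lam0 x0 x1; rewrite /qMP_density lambda_critP //.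
set g := expR (- (lam * c)); set s := expR (- lam).
have g0 : 0 < g by exact: expR_gt0.
have g1 : g <= 1 by rewrite -expR0 ler_expR oppr_le0 mulr_ge0 // ltW.
have s0 : 0 < s by exact: expR_gt0.
have s1 : s < 1 by rewrite -expR0 ltr_expR oppr_lt0.
have sg1 : s * g < 1 by rewrite (@le_lt_trans _ _ s) // ler_piMr // ltW.
have sc : s `^ (c + 1) = s * g by rewrite -expRM -expRD; congr expR; ring.
pose m := s * Num.sqrt g; pose l := Num.sqrt ((1 - s) * (1 - s * g)).
pose w := Num.sqrt (1 - x).
have w0 : 0 < w by rewrite sqrtr_gt0; lra.
have m0 : 0 < m by rewrite mulr_gt0 // sqrtr_gt0.
have l0 : 0 < l by rewrite sqrtr_gt0 mulr_gt0 //; lra.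
have m2 : m ^+ 2 = s ^+ 2 * g by rewrite exprMn sqr_sqrtr // ltW.
have l2 : l ^+ 2 = (1 - s) * (1 - s * g) by rewrite sqr_sqrtr // mulr_ge0 //; lra.
have w2 : w ^+ 2 = 1 - x by rewrite sqr_sqrtr //; lra.
have ml : Num.sqrt (s * (1 - s * g)) * Num.sqrt (s * g * (1 - s)) = m * l.
  rewrite -sqrtrM; last by rewrite mulr_ge0 //; lra.
  have -> : s * (1 - s * g) * (s * g * (1 - s)) = (m * l) ^+ 2.
    by rewrite exprMn m2 l2; ring.
  by rewrite sqrtr_sqr ger0_norm // mulr_ge0 // ltW.
have A0 : 0 <= s * (1 - s * g) by rewrite mulr_ge0 //; lra.
have B0 : 0 <= s * g * (1 - s) by rewrite !mulr_ge0 //; lra.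
have aE : 1 - qMP_a c lam = (m + l) ^+ 2.
  rewrite /qMP_a -/s sc sqrrB !sqr_sqrtr // ml sqrrD m2 l2; ring.
have bE : 1 - qMP_b c lam = (m - l) ^+ 2.
  rewrite /qMP_b -/s sc sqrrD !sqr_sqrtr // ml sqrrB m2 l2; ring.
have sa : Num.sqrt (1 - qMP_a c lam) = m + l.
  by rewrite aE sqrtr_sqr ger0_norm // addr_ge0 // ltW.
have ax : (qMP_a c lam < x) = (w < m + l).
  by rewrite -[RHS](@ltr_pXn2r _ 2) ?nnegrE ?addr_ge0 ?ltW // w2 -aE; apply/idP/idP; lra.
have bx : (x < qMP_b c lam) = ((m - l) ^+ 2 < w ^+ 2).
  by rewrite w2 -bE; apply/idP/idP; lra.
have xb : (qMP_b c lam < x) = (w ^+ 2 < (m - l) ^+ 2).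
  by rewrite w2 -bE; apply/idP/idP; lra.
have YE : qMP_cos g (expR lam) x = (w ^+ 2 + m ^+ 2 - l ^+ 2) / (2 * m * w).
  rewrite /qMP_cos sqrtrM ?(ltW g0) // w2 m2 l2 /m -/w.
  have -> : expR lam = s^-1 by rewrite /s expRN invrK.
  have := sqr_sqrtr (ltW g0); have : Num.sqrt g != 0 by rewrite lt0r_neq0 // sqrtr_gt0.
  move: (Num.sqrt g) => h h0 hE; field; by rewrite h0 !lt0r_neq0.
have xaE : x - qMP_a c lam = (m + l) ^+ 2 - w ^+ 2 by rewrite -aE w2; ring.
have bxE : qMP_b c lam - x = w ^+ 2 - (m - l) ^+ 2 by rewrite -bE w2; ring.
have x0' := lt0r_neq0 x0; have lam0' := lt0r_neq0 lam0.
have pi0 : (pi : R) != 0 by rewrite lt0r_neq0 // pi_gt0.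
rewrite /qMP_angle YE sa -/w => xnb.
have {}xnb : (m - l) ^+ 2 != w ^+ 2.
  by rewrite w2 -bE; apply: contraNneq xnb => h; apply/eqP; lra.
(* [m^2 - l^2 = s (1 + g) - 1]: criticality is the isosceles case [l = m], that is [b = 1]. *)
have -> : (1 <= s * (1 + g)) = (l <= m).
  rewrite -[RHS](@ler_pXn2r _ 2) ?nnegrE ?(ltW l0) ?(ltW m0) // m2 l2; apply/idP/idP; nra.
have [lm|ml'] := leP l m.
  have sb : Num.sqrt (1 - qMP_b c lam) = m - l.
    by rewrite bE sqrtr_sqr ger0_norm // subr_ge0.
  have bx' : ((m - l) ^+ 2 < w ^+ 2) = (m - l < w).
    by rewrite (@ltr_pXn2r _ 2) ?nnegrE ?subr_ge0 //; exact: ltW.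
  rewrite ax bx bx' sb xaE bxE; case: ifPn => [/andP[h1 h2]|].
    rewrite clip_id; last first.
      have/andP[h3 h4] : -1 < (w ^+ 2 + m ^+ 2 - l ^+ 2) / (2 * m * w) < 1.
        by apply: triangle_cos_itv => //; lra.
      by rewrite !ltW.
    rewrite triangle_acos_sub // ?(ltW l0) //; move: (pi : R) pi0 => P P0; field; by rewrite x0' lam0' P0.
  rewrite negb_and -!leNgt => h; rewrite acos_clip_ge1 ?mul0r //.
  by apply: triangle_cos_ge1; rewrite ?(ltW l0) // orbC.
have sb : Num.sqrt (1 - qMP_b c lam) = l - m.
  by rewrite bE sqrtr_sqr distrC ger0_norm // subr_ge0 ltW.
have mlE : (m - l) ^+ 2 = (l - m) ^+ 2 by ring.
have bx' : ((l - m) ^+ 2 < w ^+ 2) = (l - m < w).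
  by rewrite (@ltr_pXn2r _ 2) ?nnegrE ?subr_ge0 //; exact: ltW.
have xb' : (w ^+ 2 < (l - m) ^+ 2) = (w < l - m).
  by rewrite (@ltr_pXn2r _ 2) ?nnegrE ?subr_ge0 //; exact: ltW.
have xnb' : w != l - m by apply: contraNneq xnb => ->; rewrite mlE.
rewrite ax bx xb mlE bx' xb' x1 andbT sb xaE bxE mlE.
have [h2|h2] := ltP (l - m) w.
  rewrite andbT; case: ifPn => [h1|].
    have -> : (w < l - m) = false by apply/negbTE; rewrite -leNgt ltW.
    rewrite clip_id; last first.
      have/andP[h3 h4] : -1 < (w ^+ 2 + m ^+ 2 - l ^+ 2) / (2 * m * w) < 1.
        by apply: triangle_cos_itv => //; lra.
      by rewrite !ltW.
    rewrite addr0 triangle_acos_sup // ?(ltW l0) //; move: (pi : R) pi0 => P P0; field; by rewrite x0' lam0' P0.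
  rewrite -leNgt => h1.
  have -> : (w < l - m) = false by apply/negbTE; rewrite -leNgt ltW.
  rewrite acos_clip_ge1 ?mul0r ?addr0 //.
  by apply: triangle_cos_ge1; rewrite ?(ltW l0) // h1 orbT.
have h3 : w < l - m by rewrite lt_neqAle xnb' h2.
rewrite andbF add0r h3 acos_clip_leN1; first by move: (pi : R) pi0 => P P0; field; rewrite x0' lam0' P0.
by apply: triangle_cos_leN1; rewrite ?(ltW l0).
Qed.

End Density.

(** * Stieltjes transform of the density *)

Section AcosIntegral.
Context {R : realType}.
Local Notation mu := (@lebesgue_measure R).

(** [acos] is not differentiable at [-1] and [1]; continuity up to these points comes from its being
    the inverse of the continuous [cos] on the segment [[0, pi]]. *)
Lemma continuous_acos_clip : continuous (fun y : R => acos (clip y)).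
Proof.
have cacos : {within `[(-1), 1], continuous (@acos R)}.
  have := @segment_can_ge_continuous R 0 pi cos acos (pi_ge0 R).
  rewrite cospi cos0; apply; last exact: cosK.
  by apply: continuous_subspaceT; exact: continuous_cos.
have cclip : continuous (@clip R).
  move=> x; have h : {for x, continuous ((fun=> -1 : R) \max ((fun=> 1 : R) \min id))}.
    apply: continuous_max; first exact: cst_continuous.
    by apply: continuous_min; [exact: cst_continuous|exact: cvg_id].
  exact: h.
move=> y; apply/cvgrPdist_lt => e e0.
have cy : `[(-1), 1]%classic (clip y) by rewrite /= in_itv /= clip_itv.
have /subspace_continuousP/(_ _ cy)/cvgrPdist_lt/(_ _ e0) := cacos.
rewrite near_withinE => H.
have /(_ _ H) := cclip y; rewrite /= => {}H.
near=> x; have : `[(-1), 1]%classic (clip x) by rewrite /= in_itv /= clip_itv.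
by near: x.
Unshelve. all: by end_near. Qed.

(** [f] may blow up at the endpoints, as the inverse square roots below do. The theorem for closed
    intervals is applied inside, and monotone convergence exhausts the open interval. *)
Lemma ge0_FTC_oo (f F : R -> R) (a b : R) : a < b ->
  {in `]a, b[, forall x, 0 <= f x} ->
  {in `]a, b[, continuous f} ->
  {in `]a, b[, forall x : R, is_derive x 1 F (f x)} ->
  {for a, continuous F} -> {for b, continuous F} ->
  (\int[mu]_(x in `]a, b[) (f x)%:E = (F b - F a)%:E)%E.
Proof.
move=> ab f0 cf dF Fa Fb.
(* The offset [3] gives [e n <= (b - a) / 3], so that every [A n] has positive length. *)
pose e (n : nat) : R := (b - a) / n.+3%:R.
have ba0 : 0 < b - a by rewrite subr_gt0.
have e0 n : 0 < e n by rewrite divr_gt0 // ltr0n.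
have e3 n : e n <= (b - a) / 3 by rewrite ler_pM2l // lef_pV2 ?posrE ?ltr0n // ler_nat.
have eS m n : (m <= n)%N -> e n <= e m.
  by move=> mn; rewrite ler_pM2l // lef_pV2 ?posrE ?ltr0n // ler_nat !ltnS.
have ecvg : e n @[n --> \oo] --> (0 : R).
  rewrite -(mulr0 (b - a)); apply: cvgMl_tmp.
  have := @cvg_harmonic R; rewrite -(cvg_shiftn 2%N); apply: cvg_trans.
  by apply: near_eq_cvg; near=> n; rewrite /= addn2.
pose A n : set R := `[a + e n, b - e n]%classic.
have Aab n : A n `<=` `]a, b[%classic.
  move=> x; rewrite /A /= !in_itv /= => /andP[h1 h2]; have := e0 n; lra.
have mf n : measurable_fun (A n) f.
  apply: (@measurable_funS _ _ _ _ `]a, b[%classic) => //.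
  apply: open_continuous_measurable_fun => //.
  by move=> x; rewrite inE => /cf.
have UA : \bigcup_n A n = `]a, b[%classic.
  apply/seteqP; split => [x [n _ /Aab]//|x].
  rewrite /= in_itv /= => /andP[ax xb].
  have [n nP] : exists n, e n < Num.min (x - a) (b - x).
    have : 0 < Num.min (x - a) (b - x) by rewrite lt_min !subr_gt0 ax.
    by move/cvgr_lt : ecvg => /[apply] -[n _ /(_ n (leqnn n)) ?]; exists n.
  exists n => //; move: nP; rewrite lt_min => /andP[h1 h2].
  by rewrite /A /= in_itv /=; lra.
have H : (\int[mu]_(x in A i) (f x)%:E)%E @[i --> \oo] --> (\int[mu]_(x in `]a, b[) (f x)%:E)%E.
  rewrite -UA; apply: ge0_nondecreasing_set_cvg_integral => //.
  - move=> m n mn; apply/subsetPset => x; rewrite /A /= !in_itv /= => /andP[h1 h2].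
    have := eS _ _ mn; lra.
  - by move=> n; exact: measurable_itv.
  - by move=> n; apply/measurable_EFinP; exact: mf.
  - by move=> n x /Aab xab; rewrite lee_fin f0.
have IE n : (\int[mu]_(x in A n) (f x)%:E = (F (b - e n) - F (a + e n))%:E)%E.
  have h : a + e n < b - e n by have := e3 n; have := e0 n; lra.
  have sub x : x \in `[a + e n, b - e n] -> x \in `]a, b[ by move=> xA; exact: (Aab n).
  have cF x : x \in `]a, b[ -> {for x, continuous F}.
    move=> /dF h'; apply: differentiable_continuous; apply/derivable1_diffP.
    exact: ex_derive.
  rewrite (@continuous_FTC2 R f F) //.
  - apply: continuous_in_subspaceT => x; rewrite inE => /sub; exact: cf.
  - split.
    + move=> x xA; apply: (@ex_derive _ _ _ _ _ _ _ (dF x _)); apply: sub.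
      by apply: subset_itv_oo_cc.
    + apply: cvg_at_right_filter; apply: cF; apply: sub; rewrite in_itv /= lexx /= ltW //.
    + apply: cvg_at_left_filter; apply: cF; apply: sub; rewrite in_itv /= lexx andbT ltW //.
  - move=> x xA; rewrite derive1E; have /dF h' : x \in `]a, b[.
      by apply: sub; apply: subset_itv_oo_cc.
    exact: derive_val.
have : (\int[mu]_(x in A i) (f x)%:E)%E @[i --> \oo] --> (F b - F a)%:E.
  under eq_fun do rewrite IE.
  apply: cvg_EFin; first exact: nearW.
  apply: cvgB.
    apply: continuous_cvg => //; rewrite -[X in _ --> X]subr0.
    by apply: cvgB => //; exact: cvg_cst.
  apply: continuous_cvg => //; rewrite -[X in _ --> X]addr0.
  by apply: cvgD => //; exact: cvg_cst.
by move/cvg_lim => <- //; apply/esym/cvg_lim.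
Unshelve. all: by end_near. Qed.

Lemma integral_acos_comp (phi dphi : R -> R) (a b k : R) : a < b -> 0 <= k ->
  {in `]a, b[, forall x, -1 < phi x < 1} ->
  {in `]a, b[, forall x, dphi x <= 0} ->
  {in `]a, b[, continuous dphi} ->
  {in `]a, b[, forall x : R, is_derive x 1 phi (dphi x)} ->
  {for a, continuous phi} -> {for b, continuous phi} ->
  (\int[mu]_(x in `]a, b[) (k * (- dphi x / Num.sqrt (1 - phi x ^+ 2)))%:E =
    (k * (acos (clip (phi b)) - acos (clip (phi a))))%:E)%E.
Proof.
move=> ab k0 phi1 dphi0 cdphi dphiP pa pb; rewrite mulrBr.
have s0 x : x \in `]a, b[ -> 0 < 1 - phi x ^+ 2.
  by move=> /phi1/andP[h1 h2]; nra.
have cphi x : x \in `]a, b[ -> {for x, continuous phi}.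
  move=> /dphiP h; apply: differentiable_continuous; apply/derivable1_diffP.
  exact: ex_derive.
apply: (@ge0_FTC_oo _ (fun x => k * acos (clip (phi x)))) => //.
- by move=> x xab; rewrite mulr_ge0 // divr_ge0 ?sqrtr_ge0 // oppr_ge0 dphi0.
- move=> x xab; apply: cvgMl_tmp; apply: cvgM; first by apply: cvgN; exact: cdphi.
  apply: cvgV; first by rewrite lt0r_neq0 // sqrtr_gt0 s0.
  apply: continuous_comp; last exact: sqrt_continuous.
  by apply: cvgB; [exact: cvg_cst|exact: (@cvg_comp _ _ _ phi (fun y : R => y ^+ 2) _ _ _ (cphi x xab) (@exprn_continuous R 2 (phi x)))].
- move=> x xab.
  have h : is_derive x 1 (@acos R \o phi) (- dphi x / Num.sqrt (1 - phi x ^+ 2)).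
    have -> : - dphi x / Num.sqrt (1 - phi x ^+ 2) =
      - (Num.sqrt (1 - phi x ^+ 2))^-1 * dphi x by rewrite !mulNr mulrC.
    by apply: is_derive1_comp (dphiP x xab); apply: is_derive1_acos; exact: phi1.
  apply: near_eq_is_derive (@is_deriveZ _ _ _ _ k _ _ _ h).
  near=> y; have yab : y \in `]a, b[ by near: y; exact: near_in_itvoo.
  by rewrite /= clip_id //; have /andP[? ?] := phi1 y yab; rewrite !ltW.
- apply: cvgMl_tmp; exact: (@continuous_comp _ _ _ phi (fun y => acos (clip y)) _ pa (@continuous_acos_clip (phi a))).
- apply: cvgMl_tmp; exact: (@continuous_comp _ _ _ phi (fun y => acos (clip y)) _ pb (@continuous_acos_clip (phi b))).
Unshelve. all: by end_near. Qed.

End AcosIntegral.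

Section KernelIntegrals.
Context {R : realType}.
Local Notation mu := (@lebesgue_measure R).

(* [Num.sqrt] and [^-1] send nonpositive numbers and [0] to [0], so that
   [(Num.sqrt (qMP_discr g x v))^-1] vanishes off the region [0 < qMP_discr g x v]. *)
Definition qMP_discr (g x v : R) : R := 4 * g * (1 - x) - (x * v - (1 + g)) ^+ 2.

Lemma is_derive_affine (p k v : R) : is_derive v 1 (fun v : R => p + k * v) k.
Proof.
rewrite [X in is_derive _ _ X _](_ : _ = cst p + k \*: @id R); last by apply/funext.
by apply: is_derive_eq; rewrite add0r scaler1.
Qed.

(** In [v], the angle has derivative [x / sqrt D] between the zeros [vm] and [vp] of
    [D = qMP_discr g x v], where the cosine is [1] and [-1]. The arithmetic-geometric mean
    inequality [hle] gives [vm >= 1], so the lower limit [1] cuts nothing off; beyond [vp] the angle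
    stays equal to [pi]. *)
Lemma integral_qMP_discr_v (g x V : R) : 0 < g -> g <= 1 -> 0 < x -> x < 1 -> 1 < V ->
  (\int[mu]_(v in `]1%R, V[) ((Num.sqrt (qMP_discr g x v))^-1)%:E =
   (qMP_angle g V x / x)%:E)%E.
Proof.
move=> g0 g1 x0 x1 V1.
have [h [h0 h2 hE]] : exists h, [/\ 0 < h, h ^+ 2 = 4 * g * (1 - x) &
    forall v, qMP_cos g v x = (1 + g - x * v) / h].
  exists (2 * Num.sqrt (g * (1 - x))); split => //.
    by rewrite mulr_gt0 // sqrtr_gt0 mulr_gt0 //; lra.
  rewrite exprMn sqr_sqrtr; first by ring.
  by rewrite mulr_ge0 //; lra.
have hle : h <= 1 - x + g.
  rewrite -(@ler_pXn2r _ 2) ?nnegrE ?(ltW h0) //; last by lra.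
  by rewrite h2; have := sqr_ge0 (1 - x - g); rewrite !expr2; nra.
have [vm [vmE vm1]] : exists vm, x * vm = 1 + g - h /\ 1 <= vm.
  exists ((1 + g - h) / x); split; first by field; rewrite lt0r_neq0.
  by rewrite ler_pdivlMr //; lra.
have [vp vpE] : exists vp, x * vp = 1 + g + h.
  by exists ((1 + g + h) / x); field; rewrite lt0r_neq0.
have xle v w : (x * v <= x * w) = (v <= w) by rewrite ler_pM2l.
have xlt v w : (x * v < x * w) = (v < w) by rewrite ltr_pM2l.
have DE v : qMP_discr g x v = (x * v - x * vm) * (x * vp - x * v).
  by rewrite /qMP_discr -h2 vmE vpE; ring.
have D0 v : (v <= vm) || (vp <= v) -> (Num.sqrt (qMP_discr g x v))^-1 = 0.
  move=> hv; suff : qMP_discr g x v <= 0 by move=> /ler0_sqrtr ->; rewrite invr0.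
  rewrite DE; have : x * vm < x * vp by rewrite vmE vpE; lra.
  case/orP: hv; rewrite -xle => hv hmp.
    by apply: mulr_le0_ge0; lra.
  by apply: mulr_ge0_le0; lra.
have h' := lt0r_neq0 h0.
have x' := lt0r_neq0 x0.
have [Vm|Vm] := leP V vm.
  rewrite /qMP_angle hE acos_clip_ge1 ?mul0r; last first.
    by rewrite ler_pdivlMr // mul1r; move: Vm; rewrite -xle; lra.
  apply: integral0_eq => v /=; rewrite in_itv /= => /andP[_ vV].
  by rewrite D0 // (le_trans (ltW vV) Vm).
have vmp : vm < vp by rewrite -xlt vmE vpE; lra.
set m := Num.min vp V.
have vmm : vm < m by rewrite lt_min vmp.
transitivity (\int[mu]_(v in `]vm, m[) ((Num.sqrt (qMP_discr g x v))^-1)%:E)%E.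
  rewrite integral_mkcond [RHS]integral_mkcond; apply: eq_integral => v _.
  rewrite !patchE; case: ifPn => [v1|v1]; case: ifPn => v2 //.
    rewrite D0 //; move: v1 v2; rewrite inE notin_setE /= !in_itv /= => /andP[v1 v2].
    by rewrite lt_min v2 andbT => /negP; rewrite negb_and -!leNgt.
  move: v2; rewrite inE /= in_itv /= lt_min => /and3P[h3 h4 h5].
  move: v1; rewrite notin_setE /= in_itv /= h5 andbT => /negP; rewrite -leNgt => ?; exfalso; lra.
transitivity (\int[mu]_(v in `]vm, m[)
   (x^-1 * (- (- (x / h)) / Num.sqrt (1 - ((1 + g - x * v) / h) ^+ 2)))%:E)%E.
  apply: eq_integral => v; rewrite inE /= in_itv /= => /andP[v1 v2]; congr EFin.
  have vvp : v < vp by move: v2; rewrite lt_min => /andP[].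
  have Dp : 0 < qMP_discr g x v.
    by rewrite DE mulr_gt0 // subr_gt0 xlt.
  have -> : 1 - ((1 + g - x * v) / h) ^+ 2 = qMP_discr g x v / h ^+ 2.
    by rewrite /qMP_discr -h2; field.
  rewrite sqrtrM ?(ltW Dp) // sqrtrV ?sqr_ge0 // sqrtr_sqr (gtr0_norm h0).
  have := lt0r_neq0 Dp; have : Num.sqrt (qMP_discr g x v) != 0.
    by rewrite lt0r_neq0 // sqrtr_gt0.
  by move=> Ds _; field; rewrite x' h' Ds.
have cphi v : {for v, continuous (fun v : R => (1 + g - x * v) / h)}.
  apply: cvgMr_tmp; apply: cvgB; first exact: cvg_cst.
  by apply: cvgMl_tmp; exact: cvg_id.
rewrite (@integral_acos_comp _ (fun v => (1 + g - x * v) / h) (fun=> - (x / h))) //.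
- congr EFin; rewrite mulrC; congr (_ * _).
  rewrite (@acos_clip_ge1 _ ((1 + g - x * vm) / h)) ?subr0; last first.
    by rewrite vmE ler_pdivlMr // mul1r; lra.
  rewrite /qMP_angle hE /m; case: (leP vp V) => // vpV.
  rewrite !acos_clip_leN1 //; first by rewrite ler_pdivrMr // mulN1r; move: vpV; rewrite -xle; lra.
  by rewrite ler_pdivrMr // mulN1r; lra.
- by rewrite invr_ge0 ltW.
- move=> v; rewrite in_itv /= => /andP[v1]; rewrite lt_min => /andP[v2 _].
  have v1' : x * vm < x * v by rewrite xlt.
  have v2' : x * v < x * vp by rewrite xlt.
  by rewrite ltr_pdivlMr // ltr_pdivrMr //; lra.
- by move=> v _; rewrite oppr_le0 divr_ge0 // ltW.
- by move=> v _; exact: cst_continuous.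
- move=> v _; have := is_derive_affine ((1 + g) / h) (- (x / h)) v.
  by under eq_fun do rewrite mulNr mulrAC -mulrBl.
Qed.

Lemma is_derive_inv_shift (z x : R) : x + z != 0 ->
  is_derive x 1 (fun x : R => (x + z)^-1) (- (x + z) ^- 2).
Proof.
move=> xz; have h := is_derive_affine z 1 x.
have {}h : is_derive x 1 (fun x : R => x + z) 1.
  by move: h; under eq_fun do rewrite mul1r addrC.
have := @is_deriveV R (fun x => x + z) x 1 1 xz h.
by rewrite /GRing.scale /= mulr1.
Qed.

(** In [x] the kernel is the arcsine weight [1 / (v sqrt ((x - a)(b - x)))]. The substitution
    [y = 1 / (x + z)] turns it, with the factor [1 / (x + z)], into an arcsine weight on the
    interval with centre [mid] and half-length [half]; the angle swept there is [pi]. *)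
Lemma integral_qMP_discr_x (g z v : R) : 0 < g -> g <= 1 -> 0 < z -> 1 < v ->
  (\int[mu]_(x in `]0%R, 1%R[) ((x + z)^-1 * (Num.sqrt (qMP_discr g x v))^-1)%:E =
   (pi / Num.sqrt ((1 + g + z * v) ^+ 2 - 4 * g * (1 + z)))%:E)%E.
Proof.
move=> g0 g1 z0 v1.
have v0 : 0 < v by lra.
have v' := lt0r_neq0 v0.
(* [P] and [Q] parametrize the zeros of [qMP_discr] in [x], which are [((P - Q) / v)^2] and
   [((P + Q) / v)^2]. They are distinct because [v > 1] makes [Q] positive. *)
have [P [P0 P2]] : exists P, 0 < P /\ P ^+ 2 = v - g.
  by exists (Num.sqrt (v - g)); rewrite sqrtr_gt0 sqr_sqrtr; [split|]; lra.
have [Q [Q0 Q2]] : exists Q, 0 < Q /\ Q ^+ 2 = g * (v - 1).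
  by exists (Num.sqrt (g * (v - 1))); rewrite sqrtr_gt0 sqr_sqrtr; [split|]; nra.
have [a aE] : exists a, a = ((P - Q) / v) ^+ 2 by eexists.
have [b bE] : exists b, b = ((P + Q) / v) ^+ 2 by eexists.
have a0 : 0 <= a by rewrite aE sqr_ge0.
have ab : a < b.
  rewrite -subr_gt0; have -> : b - a = 4 * P * Q / v ^+ 2 by rewrite aE bE; field.
  by rewrite divr_gt0 ?exprn_gt0 // !mulr_gt0.
have b1 : b <= 1.
  rewrite bE expr_div_n ler_pdivrMr ?exprn_gt0 // mul1r.
  rewrite -subr_ge0.
  have PQ : (P * Q) ^+ 2 = g * (v - 1) * (v - g) by rewrite exprMn P2 Q2; ring.
  have h1 : 0 <= v ^+ 2 - (P ^+ 2 + Q ^+ 2) by rewrite P2 Q2; nra.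
  have h2 : (2 * (P * Q)) ^+ 2 <= (v ^+ 2 - (P ^+ 2 + Q ^+ 2)) ^+ 2.
    rewrite exprMn PQ P2 Q2 -subr_ge0.
    have -> : (v ^+ 2 - (v - g + g * (v - 1))) ^+ 2 - 2 ^+ 2 * (g * (v - 1) * (v - g)) =
      ((v - 1) * (v - g) - g) ^+ 2 by ring.
    exact: sqr_ge0.
  have h3 : 2 * (P * Q) <= v ^+ 2 - (P ^+ 2 + Q ^+ 2).
    rewrite -(@ler_pXn2r _ 2) // nnegrE; exact/ltW/mulr_gt0/mulr_gt0.
  have -> : v ^+ 2 - (P + Q) ^+ 2 = v ^+ 2 - (P ^+ 2 + Q ^+ 2) - 2 * (P * Q) by ring.
  by rewrite subr_ge0.
have DE x : qMP_discr g x v = v ^+ 2 * ((x - a) * (b - x)).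
  have -> : v ^+ 2 * ((x - a) * (b - x)) =
    - (v * x) ^+ 2 + 2 * (P ^+ 2 + Q ^+ 2) * x - (P ^+ 2 - Q ^+ 2) ^+ 2 / v ^+ 2.
    by rewrite aE bE; field.
  by rewrite P2 Q2 /qMP_discr; field.
have zE : (1 + g + z * v) ^+ 2 - 4 * g * (1 + z) = v ^+ 2 * ((z + a) * (z + b)).
  (* The radicand is [- qMP_discr g (- z) v], so the factorization applies at [- z]. *)
  have := DE (- z); rewrite /qMP_discr => h.
  have -> : v ^+ 2 * ((z + a) * (z + b)) = - (v ^+ 2 * ((- z - a) * (b - - z))) by ring.
  by rewrite -h; ring.
have za : 0 < z + a by lra.
have zb : 0 < z + b by lra.
have za' := lt0r_neq0 za; have zb' := lt0r_neq0 zb.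
have [W [W0 W2]] : exists W, 0 < W /\ W ^+ 2 = (z + a) * (z + b).
  exists (Num.sqrt ((z + a) * (z + b))); rewrite sqrtr_gt0 sqr_sqrtr ?mulr_ge0 ?ltW //.
  by rewrite mulr_gt0.
have W' := lt0r_neq0 W0.
have -> : Num.sqrt ((1 + g + z * v) ^+ 2 - 4 * g * (1 + z)) = v * W.
  by rewrite zE -W2 -exprMn sqrtr_sqr gtr0_norm // mulr_gt0.
have D0 x : (x <= a) || (b <= x) -> (Num.sqrt (qMP_discr g x v))^-1 = 0.
  move=> hx; suff : qMP_discr g x v <= 0 by move=> /ler0_sqrtr ->; rewrite invr0.
  rewrite DE pmulr_rle0 ?exprn_gt0 //; case/orP: hx => hx.
    by apply: mulr_le0_ge0; lra.
  by apply: mulr_ge0_le0; lra.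
have [mid midE] : exists mid, mid = ((z + a)^-1 + (z + b)^-1) / 2 by eexists.
have [half halfE] : exists half, half = ((z + a)^-1 - (z + b)^-1) / 2 by eexists.
have half0 : 0 < half.
  by rewrite halfE divr_gt0 // subr_gt0 ltf_pV2 ?posrE //; lra.
have half' := lt0r_neq0 half0.
pose phi x := ((x + z)^-1 - mid) / half.
have phiE x : 0 < x + z -> 1 - phi x ^+ 2 =
    ((x - a) * (b - x)) / (W * (x + z) * half) ^+ 2.
  move=> xz; rewrite /phi !exprMn W2.
  have -> : 1 - ((x + z)^-1 - mid) ^+ 2 * half^-1 ^+ 2 =
    (half ^+ 2 - ((x + z)^-1 - mid) ^+ 2) / half ^+ 2.
    by field; rewrite half' lt0r_neq0.
  have -> : half ^+ 2 - ((x + z)^-1 - mid) ^+ 2 =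
    ((x - a) * (b - x)) / ((z + a) * (z + b) * (x + z) ^+ 2).
    rewrite halfE midE; field; by rewrite za' zb' lt0r_neq0.
  by field; rewrite half' za' zb' lt0r_neq0.
transitivity (\int[mu]_(x in `]a, b[)
    ((x + z)^-1 * (Num.sqrt (qMP_discr g x v))^-1)%:E)%E.
  rewrite integral_mkcond [RHS]integral_mkcond; apply: eq_integral => x _.
  rewrite !patchE; case: ifPn => [x1|x1]; case: ifPn => x2 //.
    rewrite D0 ?mulr0 //; move: x2; rewrite notin_setE /= in_itv /= => /negP.
    by rewrite negb_and -!leNgt.
  move: x2 x1; rewrite inE notin_setE /= !in_itv /= => /andP[x1 x2] [].
  by rewrite (le_lt_trans a0 x1) (lt_le_trans x2 b1).
transitivity (\int[mu]_(x in `]a, b[)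
   ((v * W)^-1 * (- (- ((x + z) ^- 2 / half)) / Num.sqrt (1 - phi x ^+ 2)))%:E)%E.
  apply: eq_integral => x; rewrite inE /= in_itv /= => /andP[x1 x2]; congr EFin.
  have xz : 0 < x + z by lra.
  have xz' := lt0r_neq0 xz.
  have S0 : 0 < (x - a) * (b - x) by rewrite mulr_gt0 // subr_gt0.
  rewrite phiE // DE sqrtrM ?sqr_ge0 // sqrtr_sqr (gtr0_norm v0).
  rewrite (sqrtrM _ (ltW S0)) sqrtrV ?sqr_ge0 // sqrtr_sqr gtr0_norm; last first.
    by rewrite !mulr_gt0.
  have : Num.sqrt ((x - a) * (b - x)) != 0 by rewrite lt0r_neq0 // sqrtr_gt0.
  by move: (Num.sqrt _) => S S'; field; rewrite xz' half' S' W' v'.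
have dphi x : x + z != 0 -> is_derive x 1 phi (- ((x + z) ^- 2 / half)).
  move=> xz; have h1 := is_derive_inv_shift z x xz.
  have h2 : is_derive ((x + z)^-1) 1 (fun t : R => (t - mid) / half) half^-1.
    have := is_derive_affine (- mid / half) half^-1 ((x + z)^-1).
    by under eq_fun do rewrite addrC [X in X + _]mulrC -mulrDl.
  have := @is_derive1_comp R (fun t => (t - mid) / half) (fun x => (x + z)^-1) x _ _ h2 h1.
  by rewrite mulrC mulNr.
have cphi x : x + z != 0 -> {for x, continuous phi}.
  move=> /dphi h; apply: differentiable_continuous; apply/derivable1_diffP.
  exact: ex_derive.
rewrite (@integral_acos_comp _ phi (fun x => - ((x + z) ^- 2 / half))) //.
- have -> : phi b = -1.
    by rewrite /phi midE (addrC b z) halfE; field; rewrite za' zb' lt0r_neq0 //; lra.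
  have -> : phi a = 1.
    by rewrite /phi midE (addrC a z) halfE; field; rewrite za' zb' lt0r_neq0 //; lra.
  by rewrite acos_clip_leN1 // acos_clip_ge1 // subr0 mulrC.
- by rewrite invr_ge0 mulr_ge0 // ltW.
- move=> x; rewrite in_itv /= => /andP[x1 x2].
  have xz : 0 < x + z by lra.
  have : 0 < 1 - phi x ^+ 2.
    rewrite phiE // divr_gt0 //; first by rewrite mulr_gt0 // subr_gt0.
    by rewrite exprn_gt0 // !mulr_gt0.
  by move: (phi x) => y hy; apply/andP; split; nra.
- by move=> x _; rewrite oppr_le0 divr_ge0 ?(ltW half0) // invr_ge0 sqr_ge0.
- move=> x; rewrite in_itv /= => /andP[x1 x2].
  have xz : 0 < x + z by lra.
  apply: cvgN; apply: cvgMr_tmp; apply: cvgV; first by rewrite lt0r_neq0 // exprn_gt0.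
  apply: (@cvg_comp _ _ _ (fun x : R => x + z) (fun y : R => y ^+ 2)); last exact: exprn_continuous.
  by apply: cvgD; [exact: cvg_id|exact: cvg_cst].
- move=> x; rewrite in_itv /= => /andP[x1 x2].
  by apply: dphi; rewrite lt0r_neq0 //; lra.
- by apply: cphi; rewrite addrC.
- by apply: cphi; rewrite addrC.
Qed.

Lemma resolvent_root1 (g z : R) : g <= 1 -> 0 < z -> resolvent_root g z 1 = 1.
Proof.
move=> g1 z0; rewrite /resolvent_root mulr1.
have -> : (1 + g + z) ^+ 2 - 4 * g * (1 + z) = (1 + z - g) ^+ 2 by ring.
rewrite sqrtr_sqr ger0_norm; last by lra.
by field; rewrite lt0r_neq0 //; lra.
Qed.

(** With [B = 1 + g + z v] and [S] the square root, [S' = z B / S], hence [E' = z E / S]. *)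
Lemma is_derive_ln_resolvent_root (g z v : R) : 0 < g -> g <= 1 -> 0 < z -> 1 <= v ->
  is_derive v 1 (fun v => ln (resolvent_root g z v))
    (z / Num.sqrt ((1 + g + z * v) ^+ 2 - 4 * g * (1 + z))).
Proof.
move=> g0 g1 z0 v1.
have D0 : 0 < (1 + g + z * v) ^+ 2 - 4 * g * (1 + z).
  apply: lt_le_trans (resolvent_discr_ge g z v g0 g1 z0 v1).
  by rewrite exprn_gt0 //; lra.
have dB := is_derive_affine (1 + g) z v.
set B := fun v : R => 1 + g + z * v.
have dS : is_derive (B v) 1 (fun y : R => y ^+ 2 - 4 * g * (1 + z)) (2 * B v).
  rewrite [X in is_derive _ _ X _](_ : _ = (@id R) ^+ 2 - cst (4 * g * (1 + z))); last first.
    by apply/funext.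
  apply: is_derive_eq; rewrite subr0 expr1 /GRing.scale /= mulr1.
  by rewrite mulr_natl.
have dQ' := @is_derive1_comp R (fun y => y ^+ 2 - 4 * g * (1 + z)) B v _ _ dS dB.
have dQ := @is_derive1_comp R Num.sqrt ((fun y => y ^+ 2 - 4 * g * (1 + z)) \o B) v _ _
  (is_derive1_sqrt D0) dQ'.
have dE := @is_deriveZ _ _ _ _ (2 * (1 + z))^-1 _ _ _ (is_deriveD dB dQ).
have E0 : 0 < resolvent_root g z v.
  by apply: lt_le_trans (resolvent_root_ge1 g z v g0 g1 z0 v1); exact: ltr01.
have dE' : is_derive v 1 (resolvent_root g z) (resolvent_root g z v *
    (z / Num.sqrt ((1 + g + z * v) ^+ 2 - 4 * g * (1 + z)))).
  rewrite [X in is_derive _ _ X _](_ : _ = ((2 * (1 + z))^-1 \*: (B + (Num.sqrt \o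
    ((fun y : R => y ^+ 2 - 4 * g * (1 + z)) \o B))))); last first.
    by apply/funext => y; rewrite /resolvent_root mulrC.
  apply: (@is_derive_eq _ _ _ _ _ _ _ _ dE).
  rewrite /resolvent_root /= /GRing.scale /= /B.
  have : Num.sqrt ((1 + g + z * v) ^+ 2 - 4 * g * (1 + z)) != 0.
    by rewrite lt0r_neq0 // sqrtr_gt0.
  by move: (Num.sqrt _) => S S0; field; rewrite S0 lt0r_neq0 //; lra.
have := @is_derive1_comp R (@ln R) (resolvent_root g z) v _ _ (is_derive1_ln E0) dE'.
by rewrite mulrA mulVf ?mul1r // lt0r_neq0.
Qed.

Lemma integral_resolvent_v (g z V : R) : 0 < g -> g <= 1 -> 0 < z -> 1 < V ->
  (\int[mu]_(v in `]1%R, V[)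
    (z / Num.sqrt ((1 + g + z * v) ^+ 2 - 4 * g * (1 + z)))%:E =
   (ln (resolvent_root g z V))%:E)%E.
Proof.
move=> g0 g1 z0 V1.
have cF v : 1 <= v -> {for v, continuous (fun v => ln (resolvent_root g z v))}.
  move=> v1; have h := is_derive_ln_resolvent_root g z v g0 g1 z0 v1.
  by apply: differentiable_continuous; apply/derivable1_diffP; exact: ex_derive.
rewrite (@ge0_FTC_oo _ _ (fun v => ln (resolvent_root g z v))) //.
- by rewrite resolvent_root1 // ln1 subr0.
- by move=> v _; rewrite divr_ge0 ?sqrtr_ge0 // ltW.
- move=> v; rewrite in_itv /= => /andP[/ltW v1 _].
  have D0 : 0 < (1 + g + z * v) ^+ 2 - 4 * g * (1 + z).
    apply: lt_le_trans (resolvent_discr_ge g z v g0 g1 z0 v1).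
    by rewrite exprn_gt0 //; lra.
  apply: cvgMl_tmp; apply: cvgV; first by rewrite lt0r_neq0 // sqrtr_gt0.
  apply: (@cvg_comp _ _ _ (fun v => (1 + g + z * v) ^+ 2 - 4 * g * (1 + z)) Num.sqrt);
    last exact: sqrt_continuous.
  apply: cvgB; last exact: cvg_cst.
  apply: (@cvg_comp _ _ _ (fun v : R => 1 + g + z * v) (fun y : R => y ^+ 2)); last exact: exprn_continuous.
  by apply: cvgD; [exact: cvg_cst|apply: cvgMl_tmp; exact: cvg_id].
- move=> v; rewrite in_itv /= => /andP[/ltW v1 _].
  exact: is_derive_ln_resolvent_root.
- exact: cF.
- by apply: cF; exact: ltW.
Qed.

End KernelIntegrals.

(** * Approximation by resolvents *)

Section Weierstrass.
Context {R : realType}.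

(* [(bernstein n phi).[x]] is the expectation of [phi] under the binomial law (n, x),
   defined by conditioning on the first trial. *)
Fixpoint bernstein (n : nat) (phi : nat -> R) : {poly R} :=
  if n is m.+1 then 'X * bernstein m (fun k => phi k.+1) + (1 - 'X) * bernstein m phi
  else (phi 0%N)%:P.

Lemma bernsteinS n phi x : (bernstein n.+1 phi).[x] =
  x * (bernstein n (fun k => phi k.+1)).[x] + (1 - x) * (bernstein n phi).[x].
Proof. by rewrite /= !(hornerD, hornerM, hornerN, hornerX, hornerC). Qed.

Lemma bernstein_le n phi psi x : 0 <= x -> x <= 1 ->
  (forall k, (k <= n)%N -> phi k <= psi k) -> (bernstein n phi).[x] <= (bernstein n psi).[x].
Proof.
move=> x0 x1; elim: n phi psi => [|n IH] phi psi h.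
  by rewrite /= !hornerC h.
rewrite !bernsteinS lerD // ler_wpM2l ?subr_ge0 //; apply: IH => k kn; apply: h => //.
exact: leqW.
Qed.

(** The first two moments of the binomial law. All quadratics are treated at once because a success
    in the first trial shifts [k] and so changes the coefficients. *)
Lemma bernstein_quadratic n (al be ka x : R) :
  (bernstein n (fun k => al + be * k%:R + ka * k%:R ^+ 2)).[x] =
  al + be * (n%:R * x) + ka * (n%:R * x + n%:R * (n%:R - 1) * x ^+ 2).
Proof.
elim: n al be ka => [|n IH] al be ka; first by rewrite /= hornerC; ring.
rewrite bernsteinS IH.
have -> : (fun k => al + be * k.+1%:R + ka * k.+1%:R ^+ 2) =
    (fun k => (al + be + ka) + (be + 2 * ka) * k%:R + ka * k%:R ^+ 2 :> R).
  by apply/funext => k; rewrite -natr1; ring.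
by rewrite IH -natr1; ring.
Qed.

(** Chebyshev's argument: two quadratics enclose [phi], and the binomial variance is
    [n x (1 - x)]. *)
Lemma bernstein_approx n (phi : nat -> R) (y e K x : R) : 0 <= x -> x <= 1 ->
  (forall k, (k <= n)%N -> `|phi k - y| <= e + K * (k%:R - n%:R * x) ^+ 2) ->
  `|(bernstein n phi).[x] - y| <= e + K * (n%:R * (x * (1 - x))).
Proof.
move=> x0 x1 h; rewrite ler_norml; apply/andP; split.
  rewrite lerBrDl; apply: le_trans (_ : (bernstein n (fun k =>
    (y - e - K * (n%:R * x) ^+ 2) + (2 * K * n%:R * x) * k%:R + (- K) * k%:R ^+ 2)).[x] <= _).
    by rewrite bernstein_quadratic le_eqVlt; apply/orP; left; apply/eqP; ring.
  apply: bernstein_le => // k kn; have := h k kn; rewrite ler_norml => /andP[+ _].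
  rewrite lerBrDl => h'; apply: le_trans h'.
  by rewrite le_eqVlt; apply/orP; left; apply/eqP; ring.
rewrite lerBlDl; apply: le_trans (_ : (bernstein n (fun k =>
    (y + e + K * (n%:R * x) ^+ 2) + (- (2 * K * n%:R * x)) * k%:R + K * k%:R ^+ 2)).[x] <= _).
  apply: bernstein_le => // k kn; have := h k kn; rewrite ler_norml => /andP[_].
  rewrite lerBlDl => h'; apply: le_trans h' _.
  by rewrite le_eqVlt; apply/orP; left; apply/eqP; ring.
by rewrite bernstein_quadratic le_eqVlt; apply/orP; left; apply/eqP; ring.
Qed.

Lemma within_continuous_uniform (f : R -> R) (a b e : R) : {within `[a, b], continuous f} ->
  0 < e -> exists2 d, 0 < d & forall x y, x \in `[a, b] -> y \in `[a, b] ->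
    `|x - y| < d -> `|f x - f y| < e.
Proof.
move=> cf e0.
have : near_covering `[a, b]%classic by apply/compact_near_coveringP; exact: segment_compact.
move=> /(_ R (0^'+) (fun d x => x \in `[a, b] -> forall y, y \in `[a, b] -> `|x - y| < d ->
  `|f x - f y| < e)) H.
have {}H : \forall d \near 0^'+, `[a, b]%classic `<=` (fun x => x \in `[a, b] -> forall y, y \in `[a, b] -> `|x - y| < d -> `|f x - f y| < e).
  apply: H => x0 x0ab.
  have e2 : 0 < e / 2 by rewrite divr_gt0.
  have /subspace_continuousP/(_ _ x0ab)/cvgrPdist_lt/(_ _ e2) := cf.
  rewrite near_withinE => /nbhs_ballP[r /= r0 rP].
  exists (ball x0 (r / 2), [set d : R | d < r / 2]).
    split; first by exists (r / 2); rewrite //= divr_gt0.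
    by apply: nbhs_right_lt; rewrite divr_gt0.
  move=> [x d] /= [xb dr] xab y yab xyd.
  have h1 : `|f x0 - f x| < e / 2.
    apply: rP => //; apply: (@le_ball _ _ _ (r / 2)) => //; lra.
  have h2 : `|f x0 - f y| < e / 2.
    apply: rP => //; rewrite /ball /=; apply: le_lt_trans (ler_distD x _ _) _.
    by move: xb; rewrite /ball /=; lra.
  apply: le_lt_trans (ler_distD (f x0) _ _) _; rewrite (distrC (f x)); lra.
have [d [d0 dP]] : exists d, 0 < d /\ `[a, b]%classic `<=` (fun x => x \in `[a, b] -> forall y, y \in `[a, b] -> `|x - y| < d -> `|f x - f y| < e).
  have : \forall d \near 0^'+, 0 < d /\ `[a, b]%classic `<=` (fun x => x \in `[a, b] -> forall y, y \in `[a, b] -> `|x - y| < d -> `|f x - f y| < e).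
    by near=> d; split; near: d => //; exact: nbhs_right_gt.
  by move=> /filter_ex.
by exists d => // x y xab yab; apply: dP.
Unshelve. all: by end_near. Qed.

Lemma within_continuous_bounded (f : R -> R) (a b : R) : a <= b ->
  {within `[a, b], continuous f} ->
  exists2 M, 0 <= M & {in `[a, b], forall x, `|f x| <= M}.
Proof.
move=> ab cf.
have [c cab cP] := EVT_max ab cf; have [d dab dP] := EVT_min ab cf.
exists (`|f c| + `|f d|); first by rewrite addr_ge0.
move=> x xab; rewrite ler_norml; have := cP _ xab; have := dP _ xab.
have := ler_norm (f c); have := ler_norm (- f d); rewrite normrN.
have := normr_ge0 (f c); have := normr_ge0 (f d); lra.
Qed.

Lemma weierstrass_approx (f : R -> R) (e : R) : {within `[0, 1], continuous f} -> 0 < e ->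
  exists p : {poly R}, {in `[0, 1], forall x, `|f x - p.[x]| <= e}.
Proof.
move=> cf e0.
have [M M0 fM] := within_continuous_bounded f 0 1 ler01 cf.
have [d d0 dP] := within_continuous_uniform f 0 1 (e / 2) cf (divr_gt0 e0 (ltr0n R 2)).
have d20 : 0 < d ^+ 2 by rewrite exprn_gt0.
(* This size of [n] makes the variance term at most [2 M / (d^2 n) <= e / 2]. *)
have [n [n1 nP]] : exists n, (0 < n)%N /\ 4 * M / (d ^+ 2 * e) <= n%:R.
  exists (Num.bound (4 * M / (d ^+ 2 * e))).+1; split => //.
  apply: le_trans (_ : (Num.bound (4 * M / (d ^+ 2 * e)))%:R <= _); last by rewrite ler_nat.
  by apply/ltW/archi_boundP; rewrite divr_ge0 ?mulr_ge0 // ltW.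
have n0 : 0 < n%:R :> R by rewrite ltr0n.
exists (bernstein n (fun k => f (k%:R / n%:R))) => x; rewrite in_itv /= => /andP[x0 x1].
rewrite distrC.
apply: le_trans (@bernstein_approx n _ _ (e / 2) (2 * M / (d ^+ 2 * n%:R ^+ 2)) _ x0 x1 _) _.
  move=> k kn.
  have kin : k%:R / n%:R \in `[0, 1 : R].
    by rewrite in_itv /= divr_ge0 ?ler0n //= ler_pdivrMr // mul1r ler_nat.
  have xin : x \in `[0, 1] by rewrite in_itv /= x0.
  have -> : 2 * M / (d ^+ 2 * n%:R ^+ 2) * (k%:R - n%:R * x) ^+ 2 =
      2 * M * ((k%:R / n%:R - x) ^+ 2 / d ^+ 2) by field; rewrite !lt0r_neq0.
  (* Within distance [d] uniform continuity gives [e / 2]; farther away the crude bound [2 M] is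
     multiplied by a quotient that is at least [1]. *)
  have [kd|kd] := ltP `|k%:R / n%:R - x| d.
    apply: le_trans (ltW (dP _ _ kin xin kd)) _.
    rewrite lerDl; apply: mulr_ge0; first exact: mulr_ge0.
    by rewrite divr_ge0 ?sqr_ge0.
  apply: le_trans (ler_normB _ _) _.
  have h1 := fM _ kin; have h2 := fM _ xin.
  have h3 : 1 <= (k%:R / n%:R - x) ^+ 2 / d ^+ 2.
    rewrite ler_pdivlMr // mul1r -(real_normK (num_real (_ - x))).
    by rewrite lerXn2r // ?nnegrE // ltW.
  have := ler_wpM2l (mulr_ge0 (ler0n R 2) M0) h3; rewrite mulr1; lra.
have h1 : x * (1 - x) <= 1 by nra.
have h2 : 0 <= x * (1 - x) by nra.
have -> : 2 * M / (d ^+ 2 * n%:R ^+ 2) * (n%:R * (x * (1 - x))) =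
    (2 * M / (d ^+ 2 * n%:R)) * (x * (1 - x)) by field; rewrite !lt0r_neq0.
have h3 : 2 * M / (d ^+ 2 * n%:R) <= e / 2.
  rewrite ler_pdivrMr ?mulr_gt0 //; move: nP; rewrite ler_pdivrMr ?mulr_gt0 //; lra.
have h4 : 0 <= 2 * M / (d ^+ 2 * n%:R) by rewrite divr_ge0 ?mulr_ge0 // ltW.
nra.
Qed.

End Weierstrass.

Section ResolventsDetermine.
Context {R : realType}.
Local Notation C f := {within `[0 : R, 1 : R], continuous f}.

Lemma within_continuous_affine_comb (a : R) (f g : R -> R) : C f -> C g ->
  C (fun x => a * f x + g x).
Proof.
move=> /subspace_continuousP cf /subspace_continuousP cg.
apply/subspace_continuousP => x xA; apply: cvgD; last exact: cg.
by apply: cvgMl_tmp; exact: cf.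
Qed.

Lemma continuous_resolvent0 (z : R) : 0 < z -> C (fun x : R => (x + z)^-1).
Proof.
move=> z0; apply: continuous_in_subspaceT => x; rewrite inE /= in_itv /= => /andP[x0 x1].
apply: cvgV; first by rewrite lt0r_neq0 //; lra.
by apply: cvgD; [exact: cvg_id|exact: cvg_cst].
Qed.

Lemma continuous_resolvent (z : R) k : 0 < z -> C (fun x : R => x ^+ k / (x + z)).
Proof.
move=> /continuous_resolvent0/subspace_continuousP c0.
apply/subspace_continuousP => x xA; apply: cvgM; last exact: c0.
by apply: cvg_within_filter; exact: exprn_continuous.
Qed.

(* Induction on [k]: [x^(k+1)/(x + z) = x^k - z x^k/(x + z)], and [z x^k/(x + z)] tends to
   [x^k] uniformly as [z -> oo]. *)
Lemma resolvents_determine_cvg (L : nat -> (R -> R) -> R) (I : (R -> R) -> R) (M : R) :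
  (forall k (a : R) (f g : R -> R), L k (fun x => a * f x + g x) = a * L k f + L k g) ->
  (forall k (f : R -> R) (e : R), {in `[0, 1], forall x, `|f x| <= e} -> `|L k f| <= e) ->
  (forall (a : R) (f g : R -> R), C f -> C g -> I (fun x => a * f x + g x) = a * I f + I g) ->
  (forall (f : R -> R) (e : R), C f -> {in `[0, 1], forall x, `|f x| <= e} -> `|I f| <= M * e) ->
  (forall z, 0 < z -> L k (fun x => (x + z)^-1) @[k --> \oo] --> I (fun x => (x + z)^-1)) ->
  forall f : R -> R, C f -> L k f @[k --> \oo] --> I f.
Proof.
move=> Llin Lbd Ilin Ibd Lres.
pose Conv (f : R -> R) := L k f @[k --> \oo] --> I f.
have M0 : 0 <= M.
  have c1 : C (fun=> 1 : R) by apply: continuous_subspaceT; exact: cst_continuous.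
  have := Ibd _ 1 c1; rewrite mulr1 => h.
  by apply: le_trans (normr_ge0 _) (h _) => x _; rewrite normr1.
have closeP (f : R -> R) : C f -> (forall e : R, 0 < e -> exists g : R -> R, [/\ C g, Conv g &
    {in `[0, 1], forall x, `|f x - g x| <= e}]) -> Conv f.
  move=> cf H; apply/cvgrPdist_lt => eps eps0.
  (* Replacing [f] by [g] costs [M e] under [I] and [e] under [L k], and convergence at [g] less
     than [e]: in all less than [(M + 2) e <= eps]. *)
  pose e := eps / (2 * (M + 1)).
  have e0 : 0 < e by rewrite divr_gt0 // mulr_gt0 // ltr_wpDl.
  have eE : eps = 2 * (M + 1) * e by rewrite /e; field; rewrite lt0r_neq0 // ltr_wpDl.
  have [g [cg Lg fg]] := H _ e0.
  have Me : 0 <= M * e by rewrite mulr_ge0 // ltW.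
  near=> k.
  have h1 : `|I g - L k g| < e by near: k; move/cvgrPdist_lt : Lg; exact.
  have fg' : {in `[0, 1], forall x, `|-1 * g x + f x| <= e}.
    by move=> x /fg; rewrite mulN1r addrC.
  have h2 := Ibd _ e (within_continuous_affine_comb (-1) g f cg cf) fg'.
  have h3 := Lbd k _ e fg'.
  rewrite Ilin // in h2; rewrite Llin in h3.
  have -> : I f - L k f = (-1 * I g + I f) + (I g - L k g) - (-1 * L k g + L k f) by ring.
  apply: le_lt_trans (ler_normB _ _) _.
  have := ler_normD (-1 * I g + I f) (I g - L k g).
  move: h1 h2 h3; move: (`|_|) (`|_|) (`|_|) (`|_|) => p1 p2 p3 p4; lra.
have combP (a : R) (f g : R -> R) : C f -> C g -> Conv f -> Conv g -> Conv (fun x => a * f x + g x).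
  move=> cf cg Lf Lg; rewrite /Conv Ilin //; under eq_fun do rewrite Llin.
  by apply: cvgD => //; exact: cvgMl_tmp.
(* The algebraic identities used below hold on [[0, 1]], where the denominators do not vanish, so
   convergence has to pass between functions that agree only there. *)
have extP (f g : R -> R) : C f -> C g -> {in `[0, 1], f =1 g} -> Conv g -> Conv f.
  move=> cf cg fg Lg; apply: closeP => // e e0; exists g; split => // x /fg ->.
  by rewrite subrr normr0 ltW.
have c0 : C (fun=> 0 : R) by apply: continuous_subspaceT; exact: cst_continuous.
have Conv0 : Conv (fun=> 0).
  apply: (extP _ (fun x => -1 * (x + 1)^-1 + (x + 1)^-1)) => //.
  - by apply: within_continuous_affine_comb; exact: continuous_resolvent0.
  - by move=> x _; rewrite mulN1r addNr.
  - by apply: combP; try exact: Lres; exact: continuous_resolvent0.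
have cX k : C (fun x : R => x ^+ k) by apply: continuous_subspaceT; exact: exprn_continuous.
have Xof k : (forall z, 0 < z -> Conv (fun x => x ^+ k / (x + z))) -> Conv (fun x => x ^+ k).
  move=> H; apply: closeP => // e e0.
  (* For [z = 1 / e] the error [x^(k+1) / (x + z)] is at most [1 / z = e] on [[0, 1]]. *)
  have z0 : 0 < e^-1 by rewrite invr_gt0.
  exists (fun x => e^-1 * (x ^+ k / (x + e^-1)) + 0); split.
  - by apply: within_continuous_affine_comb => //; exact: continuous_resolvent.
  - by apply: combP => //; [exact: continuous_resolvent|exact: H].
  - move=> x; rewrite in_itv /= => /andP[x0 x1].
    have xz : 0 < x + e^-1 by lra.
    have -> : x ^+ k - (e^-1 * (x ^+ k / (x + e^-1)) + 0) = x ^+ k.+1 / (x + e^-1).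
      by rewrite exprS; field; rewrite !lt0r_neq0 //; nra.
    rewrite ger0_norm; last by rewrite divr_ge0 ?exprn_ge0 // ltW.
    rewrite ler_pdivrMr // mulrDr mulfV ?lt0r_neq0 //.
    have : x ^+ k.+1 <= 1 by rewrite exprn_ile1.
    have := mulr_ge0 (ltW e0) x0; lra.
have XZ k z : 0 < z -> Conv (fun x => x ^+ k / (x + z)).
  elim: k z => [|k IH] z z0.
    apply: (extP _ (fun x => (x + z)^-1)).
    - exact: continuous_resolvent.
    - exact: continuous_resolvent0.
    - by move=> x _; rewrite expr0 mul1r.
    - exact: Lres.
  apply: (extP _ (fun x => - z * (x ^+ k / (x + z)) + x ^+ k)).
  - exact: continuous_resolvent.
  - by apply: within_continuous_affine_comb => //; exact: continuous_resolvent.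
  - move=> x; rewrite in_itv /= => /andP[x0 x1].
    by rewrite exprS; field; rewrite lt0r_neq0 //; lra.
  - apply: combP => //; first exact: continuous_resolvent.
    + exact: IH.
    + by apply: Xof => z' z'0; exact: IH.
have cP (p : {poly R}) : C (fun x => p.[x]).
  by apply: continuous_subspaceT; exact: continuous_horner.
have PX (p : {poly R}) : Conv (fun x => p.[x]).
  have S n : C (fun x => \sum_(i < n) p`_i * x ^+ i) /\
      Conv (fun x => \sum_(i < n) p`_i * x ^+ i).
    elim: n => [|n [IH1 IH2]].
      have -> : (fun x => \sum_(i < 0) p`_i * x ^+ i) = (fun=> 0).
        by apply/funext => x; rewrite big_ord0.
      by [].
    have E : (fun x => \sum_(i < n.+1) p`_i * x ^+ i) =
        (fun x => p`_n * x ^+ n + \sum_(i < n) p`_i * x ^+ i).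
      by apply/funext => x; rewrite big_ord_recr /= addrC.
    rewrite E; split; first exact: within_continuous_affine_comb.
    by apply: combP => //; apply: Xof => z z0; exact: XZ.
  have [S1 S2] := S (size p).
  apply: extP (cP p) S1 _ S2 => x _; exact: horner_coef.
move=> f cf; apply: closeP => // e e0.
have [p pP] := weierstrass_approx f e cf e0.
by exists (fun x => p.[x]).
Unshelve. all: by end_near. Qed.

End ResolventsDetermine.

(** * Exchange of the two integrals *)

Section DensityResolvent.
Context {R : realType}.
Local Notation mu := (@lebesgue_measure R).

Lemma measurable_inv_sqrt (d : measure_display) (T : measurableType d) (h : T -> R) :
  measurable_fun setT h -> measurable_fun setT (fun v => (Num.sqrt (h v))^-1).
Proof.
move=> mh; rewrite (_ : (fun v => _) = (fun y : R => y `^ (-1)) \o (@Num.sqrt R) \o h).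
  apply: measurableT_comp => //; apply: measurableT_comp => //.
  by apply: continuous_measurable_fun; exact: sqrt_continuous.
by apply/funext => v /=; rewrite powR_inv1 // sqrtr_ge0.
Qed.

(* [y `^ (-1)] instead of [y^-1]: the former is known to be measurable. *)
Definition qMP_kernel (g z V : R) (p : R * R) : R :=
  if ((0 < p.1) && (p.1 < 1)) && ((1 < p.2) && (p.2 < V)) then
    (p.1 + z) `^ (-1) * (Num.sqrt (qMP_discr g p.1 p.2))^-1 else 0.

Lemma qMP_kernel_ge0 (g z V : R) p : 0 <= qMP_kernel g z V p.
Proof. by rewrite /qMP_kernel; case: ifP => // _; rewrite mulr_ge0 ?powR_ge0 ?invr_ge0 ?sqrtr_ge0. Qed.

Lemma measurable_qMP_kernel (g z V : R) : measurable_fun setT (qMP_kernel g z V).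
Proof.
apply: measurable_fun_ifT => //.
- apply: measurable_and; apply: measurable_and; apply: measurable_fun_ltr => //.
- apply: measurable_funM.
    apply: (@measurableT_comp _ _ _ _ _ _ (fun y : R => y `^ (-1))) => //.
    by apply: measurable_funD.
  apply: measurable_inv_sqrt; apply: measurable_funB.
    by apply: measurable_funM => //; apply: measurable_funB.
  apply: measurable_funX; apply: measurable_funB => //.
  exact: measurable_funM.
Qed.

(** The kernel, extended by zero to the plane, is nonnegative and measurable, so Tonelli applies
    without prior integrability; finiteness of the left side comes out as a result. *)
Lemma integral_qMP_angle (g z V : R) : 0 < g -> g <= 1 -> 0 < z -> 1 < V ->
  (\int[mu]_(x in `]0%R, 1%R[) ((x + z)^-1 * (qMP_angle g V x / x))%:E =
   (pi / z * ln (resolvent_root g z V))%:E)%E.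
Proof.
move=> g0 g1 z0 V1.
have mk := measurable_qMP_kernel g z V.
transitivity (\int[mu]_x \int[mu]_v (qMP_kernel g z V (x, v))%:E)%E.
  rewrite integral_mkcond; apply: eq_integral => x _; rewrite patchE.
  case: ifPn => [|xn].
    rewrite inE /= in_itv /= => /andP[x0 x1].
    have xz : 0 <= x + z by lra.
    transitivity (\int[mu]_(v in `]1%R, V[) ((x + z)^-1%:E * ((Num.sqrt (qMP_discr g x v))^-1)%:E))%E.
      have mS : measurable_fun `]1%R, V[ (fun v => ((Num.sqrt (qMP_discr g x v))^-1)%:E).
        apply/measurable_EFinP; apply: measurable_funTS; apply: measurable_inv_sqrt.
        apply: measurable_funB => //; apply: measurable_funX; apply: measurable_funB => //.
      have S0 v : `]1%R, V[%classic v -> (0 <= ((Num.sqrt (qMP_discr g x v))^-1)%:E)%E.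
        by rewrite lee_fin invr_ge0 sqrtr_ge0.
      rewrite (ge0_integralZl_EFin mu (measurable_itv _) S0 mS) ?invr_ge0 //.
      by rewrite integral_qMP_discr_v.
    rewrite integral_mkcond; apply: eq_integral => v _; rewrite patchE /qMP_kernel /= x0 x1 /=.
    case: ifPn => [|vn].
      rewrite inE /= in_itv /= => ->; rewrite -EFinM; congr EFin.
      by rewrite powR_inv1.
    by move: vn; rewrite notin_setE /= in_itv /= => /negP/negbTE ->.
  rewrite integral0_eq // => v _; rewrite /qMP_kernel /=.
  by move: xn; rewrite notin_setE /= in_itv /= => /negP/negbTE ->.
transitivity (\int[mu]_v \int[mu]_x (qMP_kernel g z V (x, v))%:E)%E.
  apply: (@fubini_tonelli _ _ _ _ R mu mu (fun p => (qMP_kernel g z V p)%:E)).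
    exact/measurable_EFinP.
  by move=> p; rewrite lee_fin qMP_kernel_ge0.
transitivity (\int[mu]_(v in `]1%R, V[)
   ((pi / z)%:E * (z / Num.sqrt ((1 + g + z * v) ^+ 2 - 4 * g * (1 + z)))%:E))%E; last first.
  have mS : measurable_fun `]1%R, V[
      (fun v => (z / Num.sqrt ((1 + g + z * v) ^+ 2 - 4 * g * (1 + z)))%:E).
    apply/measurable_EFinP; apply: measurable_funTS; apply: measurable_funM => //.
    apply: measurable_inv_sqrt; apply: measurable_funB => //; apply: measurable_funX.
    exact: measurable_funD.
  have S0 v : `]1%R, V[%classic v ->
      (0 <= (z / Num.sqrt ((1 + g + z * v) ^+ 2 - 4 * g * (1 + z)))%:E)%E.
    by rewrite lee_fin divr_ge0 ?sqrtr_ge0 // ltW.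
  rewrite (ge0_integralZl_EFin mu (measurable_itv _) S0 mS) ?divr_ge0 ?pi_ge0 ?(ltW z0) //.
  by rewrite integral_resolvent_v.
rewrite [RHS]integral_mkcond; apply: eq_integral => v _; rewrite patchE.
case: ifPn => [|vn]; last first.
  rewrite integral0_eq // => x _; rewrite /qMP_kernel /=.
  by move: vn; rewrite notin_setE /= in_itv /= => /negP/negbTE ->; rewrite andbF.
rewrite inE /= in_itv /= => /andP[v1 vV].
transitivity (\int[mu]_(x in `]0%R, 1%R[) ((x + z)^-1 * (Num.sqrt (qMP_discr g x v))^-1)%:E)%E.
  rewrite [RHS]integral_mkcond; apply: eq_integral => x _; rewrite patchE /qMP_kernel /= v1 vV andbT.
  case: ifPn => [x01|xn].
    have /andP[x0 x1] := x01.
    rewrite mem_set /= ?in_itv //=.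
    by rewrite powR_inv1 //; lra.
  have xn' : ~ `]0%R, 1%R[%classic x by rewrite /= in_itv /= => x01; rewrite x01 in xn.
  by rewrite memNset.
rewrite integral_qMP_discr_x // -EFinM; congr EFin.
have S0 : Num.sqrt ((1 + g + z * v) ^+ 2 - 4 * g * (1 + z)) != 0.
  rewrite lt0r_neq0 // sqrtr_gt0.
  apply: lt_le_trans (resolvent_discr_ge g z v g0 g1 z0 (ltW v1)).
  by rewrite exprn_gt0 //; lra.
by move: (Num.sqrt _) S0 (pi : R) => S S0 p; field; rewrite S0 lt0r_neq0.
Qed.

End DensityResolvent.

(** * Integration of continuous functions against the density *)

Section WeightedIntegral.
Context {R : realType}.
Local Notation mu := (@lebesgue_measure R).
Local Notation D := (`]0%R, 1%R[%classic : set R).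

Lemma within_continuous_measurable (f : R -> R) : {within `[0, 1], continuous f} ->
  measurable_fun D f.
Proof.
move=> cf; apply: (@measurable_funS _ _ _ _ (`[0, 1]%classic : set R)) => //.
  exact: subset_itv_oo_cc.
exact: subspace_continuous_measurable_fun.
Qed.

Lemma integrable_within_continuousM (f w : R -> R) : {within `[0, 1], continuous f} ->
  mu.-integrable D (EFin \o w) -> mu.-integrable D (EFin \o (fun x => f x * w x)).
Proof.
move=> cf iw.
have [M M0 fM] := within_continuous_bounded f 0 1 ler01 cf.
have mw : measurable_fun D w by apply/measurable_EFinP; exact: measurable_int iw.
apply: (le_integrable _ _ _ (integrableZl _ M iw)) => //.
  by apply/measurable_EFinP; apply: measurable_funM => //; exact: within_continuous_measurable.
move=> x xD; rewrite /= lee_fin !normrM ler_wpM2r //.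
rewrite (ger0_norm M0); apply: fM; exact: subset_itv_oo_cc.
Qed.

Lemma measurable_fun_setD1 (A : set R) (r : R) (h : R -> R) : measurable A ->
  measurable_fun (A `\ r) h -> measurable_fun A h.
Proof.
move=> mA mh; have [Ar|nAr] := pselect (A r); last by rewrite -(not_setD1 nAr).
rewrite -(setD1K Ar); apply/measurable_funU => //; first exact: measurableD.
by split => //; exact: measurable_fun_set1.
Qed.

(* The two integrands may differ at [0], [1] and [r]. *)
Lemma Rintegral_cc_oo_setD1 (h h' : R -> R) (r : R) : measurable_fun D h' ->
  {in D `\ r, h =1 h'} ->
  Rintegral mu `[0, 1] h = Rintegral mu D h'.
Proof.
move=> mh' hh'.
have mDr : measurable (D `\ r) by exact: measurableD.
have mh'r : measurable_fun (D `\ r) h' by apply: measurable_funS mh' => //; exact: subDsetl.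
have mhr : measurable_fun (D `\ r) h by apply: eq_measurable_fun mh'r => x /hh'.
have mh : measurable_fun D h by exact: measurable_fun_setD1 mhr.
rewrite /Rintegral; congr fine.
rewrite -integral_itv_bndo_bndc; last first.
  by apply/measurable_EFinP; exact/measurable_fun_itv_obnd_cbndP.
rewrite -integral_itv_obnd_cbnd; last exact/measurable_EFinP.
rewrite -(@integral_setD1 _ _ r) //; last exact/measurable_EFinP.
rewrite -[RHS](@integral_setD1 _ _ r) //; last exact/measurable_EFinP.
by apply: eq_integral => x /hh' ->.
Qed.

End WeightedIntegral.

Section Limit.
Context {R : realType}.
Local Notation mu := (@lebesgue_measure R).
Local Notation D := (`]0%R, 1%R[%classic : set R).

Lemma qMP_angle_ge0 (g V x : R) : 0 <= qMP_angle g V x.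
Proof. by apply: acos_ge0; exact: clip_itv. Qed.

Lemma measurable_qMP_angle (g V : R) : 0 < g -> measurable_fun D (fun x => qMP_angle g V x / x).
Proof.
move=> g0; apply: open_continuous_measurable_fun; first exact: interval_open.
move=> x; rewrite inE /= in_itv /= => /andP[x0 x1].
apply: cvgM; last by apply: cvgV; [exact: lt0r_neq0|exact: cvg_id].
apply: (@continuous_comp _ _ _ (qMP_cos g V) (fun y => acos (clip y))); last exact: continuous_acos_clip.
apply: cvgM.
  by apply: cvgB; [exact: cvg_cst|apply: cvgMr_tmp; exact: cvg_id].
apply: cvgV.
  by rewrite lt0r_neq0 // mulr_gt0 // sqrtr_gt0 mulr_gt0 //; lra.
apply: cvgMl_tmp; apply: (@cvg_comp _ _ _ (fun x : R => g * (1 - x)) Num.sqrt); last exact: sqrt_continuous.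
by apply: cvgMl_tmp; apply: cvgB; [exact: cvg_cst|exact: cvg_id].
Qed.

(** [integral_qMP_angle] at [z = 1] is finite, and [1 <= 2 / (x + 1)] on the interval. This handles
    the singularity at [0], where the weight is unbounded when [g = 1]. *)
Lemma integrable_qMP_angle (g V : R) : 0 < g -> g <= 1 -> 1 < V ->
  mu.-integrable D (EFin \o (fun x => qMP_angle g V x / x)).
Proof.
move=> g0 g1 V1.
have ma := measurable_qMP_angle g V g0.
have mh : measurable_fun D (fun x => (x + 1)^-1 * (qMP_angle g V x / x)).
  apply: measurable_funM => //; apply: within_continuous_measurable.
  exact: continuous_resolvent0.
have ih : mu.-integrable D (EFin \o (fun x => (x + 1)^-1 * (qMP_angle g V x / x))).
  apply/integrableP; split; first exact/measurable_EFinP.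
  by rewrite /= integral_fin_num_abs // integral_qMP_angle.
apply: (le_integrable _ _ _ (integrableZl _ 2 ih)) => //; first exact/measurable_EFinP.
move=> x /=; rewrite in_itv /= => /andP[x0 x1].
have a0 : 0 <= qMP_angle g V x / x by rewrite divr_ge0 ?qMP_angle_ge0 // ltW.
move: (qMP_angle g V x / x) a0 => w w0; rewrite lee_fin mulrA normrM ler_peMl // ger0_norm; last first.
  by rewrite divr_ge0 //; lra.
by rewrite ler_pdivlMr //; lra.
Qed.

Lemma Rintegral_qMP_density (c lam : R) (f : R -> R) : 0 <= c -> 0 < lam ->
  {within `[0, 1], continuous f} ->
  Rintegral mu `[0, 1] (fun x => f x * qMP_density c lam x) =
  Rintegral mu D (fun x => f x *
    ((pi * lam)^-1 * (qMP_angle (expR (- (lam * c))) (expR lam) x / x))).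
Proof.
move=> c0 lam0 cf; apply: (@Rintegral_cc_oo_setD1 _ _ _ (qMP_b c lam)).
  apply: measurable_funM; first exact: within_continuous_measurable.
  by apply: measurable_funM => //; apply: measurable_qMP_angle; exact: expR_gt0.
move=> x; rewrite inE => -[/=]; rewrite in_itv /= => /andP[x0 x1] /eqP xb.
rewrite qMP_densityE //; congr (_ * _); rewrite [in LHS]invfM; ring.
Qed.

End Limit.

(** With [V = 1 / s] this is the limit found for the zeros in [zero_counting_resolvent_cvg]. *)
Lemma Rintegral_resolvent_qMP_angle {R : realType} (g z V lam : R) :
  0 < g -> g <= 1 -> 0 < z -> 1 < V -> 0 < lam ->
  Rintegral lebesgue_measure `]0, 1[ (fun x => (x + z)^-1 *
    ((pi * lam)^-1 * (qMP_angle g V x / x))) = ln (resolvent_root g z V) / (lam * z).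
Proof.
move=> g0 g1 z0 V1 lam0.
under eq_Rintegral do rewrite mulrCA.
rewrite RintegralZl //; last first.
  apply: integrable_within_continuousM; last exact: integrable_qMP_angle.
  exact: continuous_resolvent0.
rewrite /Rintegral integral_qMP_angle //=.
have : (pi : R) != 0 by rewrite lt0r_neq0 // pi_gt0.
by move: (pi : R) => p p0; field; rewrite p0 !lt0r_neq0.
Qed.

(** With [y = lam / N], one has [y / (1 + y) <= 1 - e^-y <= y], and both bounds times [n] tend to
    [lam]. *)
Lemma cvg_onem_expRN_ratio {R : realType} (lam : R) (n N : nat -> nat) : 0 < lam ->
  (forall k, (0 < N k)%N) ->
  ((N k)%:R^-1 : R) @[k --> \oo] --> (0 : R) ->
  (n k)%:R / (N k)%:R @[k --> \oo] --> (1 : R) ->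
  (1 - expR (- (lam / (N k)%:R))) * (n k)%:R @[k --> \oo] --> lam.
Proof.
move=> lam0 hN N0 nN.
apply: (@squeeze_cvgr _ _ _ _
  (fun k => lam * ((n k)%:R / (N k)%:R) * (1 + lam * (N k)%:R^-1)^-1)
  (fun k => lam * ((n k)%:R / (N k)%:R))).
- apply: nearW => k.
  have Nk : 0 < (N k)%:R :> R by rewrite ltr0n.
  have -> : lam * ((n k)%:R / (N k)%:R) = lam / (N k)%:R * (n k)%:R by rewrite mulrCA mulrC.
  have y0 : 0 < lam / (N k)%:R by rewrite divr_gt0.
  move: (lam / _) y0 => y y0; rewrite mulrAC.
  apply/andP; split; rewrite ler_wpM2r ?ler0n //; last by have := expR_ge1Dx (- y); lra.
  have h : 1 + y <= expR y by exact: expR_ge1Dx.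
  have -> : y / (1 + y) = 1 - (1 + y)^-1 by field; rewrite lt0r_neq0 //; lra.
  by rewrite lerD2l lerN2 expRN lef_pV2 ?posrE ?expR_gt0 //; lra.
- have H : lam * ((n k)%:R / (N k)%:R) * (1 + lam * (N k)%:R^-1)^-1 @[k --> \oo] -->
      lam * 1 * (1 + lam * 0)^-1.
    apply: cvgM; first exact: cvgMl_tmp.
    apply: cvgV; first by rewrite mulr0 addr0 oner_neq0.
    by apply: cvgD; [exact: cvg_cst|exact: cvgMl_tmp].
  by move: H; rewrite mulr0 addr0 invr1 !mulr1.
- have H : lam * ((n k)%:R / (N k)%:R) @[k --> \oo] --> lam * 1 by exact: cvgMl_tmp.
  by rewrite mulr1 in H.
Qed.

Theorem theorem1p2 (R : realType) (c : R) (d : nat) (lam : R)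
  (hc : 0 <= c) (hlam : 0 < lam)
  (n N : nat -> nat)
  (hN : forall k, (0 < N k)%N)
  (hn : ((n k)%:R : R) @[k --> \oo] --> +oo)
  (hnN : (n k)%:R / (N k)%:R @[k --> \oo] --> (1 : R))
  (f : R -> R) (hf : {within `[0, 1], continuous f}) :
  zero_counting_integral (n k)
    (little_qLaguerre
       (expR (- (lam / (N k)%:R) * (c * (N k)%:R + d%:R)))
       (expR (- (lam / (N k)%:R))) (n k)) f
  @[k --> \oo]
  --> Rintegral lebesgue_measure `[0, 1] (fun x => f x * qMP_density c lam x).
Proof.
have npos : \forall k \near \oo, 0 < (n k)%:R :> R by move/cvgryPgt : hn; exact.
(* [N] tends to infinity because eventually [1 / N = (n / N) (1 / n)]. *)
have N0 : ((N k)%:R^-1 : R) @[k --> \oo] --> (0 : R).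
  rewrite -(mulr0 (1 : R)).
  apply: (@cvg_trans _ (((n k)%:R / (N k)%:R * (n k)%:R^-1 : R) @[k --> \oo])).
    apply: near_eq_cvg; near=> k.
    have nk : 0 < (n k)%:R :> R by near: k.
    by field; rewrite !lt0r_neq0 // ltr0n.
  by apply: cvgM => //; apply/gtr0_cvgV0.
set g := expR (- (lam * c)); set V := expR lam.
pose q k : R := expR (- (lam / (N k)%:R)).
pose a k : R := expR (- (lam / (N k)%:R) * (c * (N k)%:R + d%:R)).
have Nk k : 0 < (N k)%:R :> R by rewrite ltr0n.
have q01 k : 0 < q k < 1.
  by rewrite expR_gt0 /= -expR0 ltr_expR oppr_lt0 divr_gt0.
have a01 k : 0 < a k <= 1.
  rewrite expR_gt0 /= -expR0 ler_expR mulNr oppr_le0 mulr_ge0 //.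
    by rewrite divr_ge0 // ltW.
  by rewrite addr_ge0 // mulr_ge0.
have g0 : 0 < g by exact: expR_gt0.
have g1 : g <= 1 by rewrite -expR0 ler_expR oppr_le0 mulr_ge0 // ltW.
have V1 : 1 < V by rewrite -expR0 ltr_expR.
have ecvg (u : nat -> R) l : u k @[k --> \oo] --> l -> expR (u k) @[k --> \oo] --> expR l.
  by apply: continuous_cvg; exact: continuous_expR.
have qcvg : q k @[k --> \oo] --> (1 : R).
  rewrite -[X in _ --> X]expR0; apply: ecvg; rewrite -oppr0 -(mulr0 lam).
  by apply: cvgN; exact: cvgMl_tmp.
have acvg : a k @[k --> \oo] --> g.
  apply: ecvg; rewrite -[X in _ --> X]subr0 -(mulr0 (lam * d%:R)).
  (* The fixed shift [d] changes the exponent only by [lam d / N]. *)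
  apply: (@cvg_trans _ (- (lam * c) - lam * d%:R * (N k)%:R^-1 @[k --> \oo])).
    by apply: near_eq_cvg; apply: nearW => k; field; rewrite lt0r_neq0.
  by apply: cvgB; [exact: cvg_cst|exact: cvgMl_tmp].
have qncvg : q k ^+ n k @[k --> \oo] --> expR (- lam).
  rewrite /q; under eq_fun do rewrite -expRM_natr.
  apply: ecvg; rewrite -(mulr1 lam).
  apply: (@cvg_trans _ (- (lam * ((n k)%:R / (N k)%:R)) @[k --> \oo])).
    by apply: near_eq_cvg; apply: nearW => k; field; rewrite lt0r_neq0.
  by apply: cvgN; exact: cvgMl_tmp.
have Lres z : 0 < z ->
    zero_counting_integral (n k) (little_qLaguerre (a k) (q k) (n k)) (fun x => (x + z)^-1)
    @[k --> \oo] --> ln (resolvent_root g z V) / (lam * z).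
  move=> z0; have -> : V = (expR (- lam))^-1 by rewrite expRN invrK.
  apply: zero_counting_resolvent_cvg => //.
  - exact: expR_gt0.
  - by rewrite -expR0 ler_expR oppr_le0 ltW.
  - by near=> k; rewrite -(ltr0n R); near: k.
  - exact: cvg_onem_expRN_ratio.
rewrite Rintegral_qMP_density // -/g -/V.
have cC (b : R) : {within `[0, 1], continuous (fun _ : R => b)}.
  by apply: continuous_subspaceT; exact: cst_continuous.
pose w x := (pi * lam)^-1 * (qMP_angle g V x / x).
have iw : lebesgue_measure.-integrable `]0%R, 1%R[ (EFin \o w).
  exact: (integrable_within_continuousM (fun=> _) _ (cC _) (integrable_qMP_angle g V g0 g1 V1)).
pose I (h : R -> R) := Rintegral lebesgue_measure `]0, 1[ (fun x => h x * w x).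
(* Along these lists of simple zeros the counting integral is a finite average, from which linearity
   and the sup-norm bound follow. *)
have /choice[r rP] : forall k, exists r, [/\ size r = n k, uniq r,
    {in r, forall x, 0 < x < 1} & little_qLaguerre (a k) (q k) (n k) = prod_onem r].
  move=> k; have /andP[? ?] := a01 k; have /andP[? ?] := q01 k.
  exact: little_qLaguerre_zeros.
have LE k h : zero_counting_integral (n k) (little_qLaguerre (a k) (q k) (n k)) h =
    (n k)%:R^-1 * \sum_(x <- r k) h x.
  have [_ ur r01 ->] := rP k; rewrite zero_counting_integral_prod_onem //.
  by apply/negP => /r01; rewrite ltxx.
apply: (@resolvents_determine_cvg R
  (fun k => zero_counting_integral (n k) (little_qLaguerre (a k) (q k) (n k)))
  I (Rintegral lebesgue_measure `]0, 1[ (fun x => `|w x|))) hf.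
- by move=> k b h h'; rewrite !LE big_split /= -mulr_sumr mulrDr mulrCA.
- move=> k h e he; rewrite LE; have [szr _ r01 _] := rP k.
  have e0 : 0 <= e by apply: le_trans (normr_ge0 _) (he 0 _); rewrite in_itv /= lexx ler01.
  rewrite normrM normfV normr_nat.
  (* The bound is required for every [k], including those with [n k = 0], where the average is an
     empty sum. *)
  have [nk0|nk] := posnP (n k).
    by move: szr; rewrite nk0 => /size0nil ->; rewrite big_nil normr0 mulr0.
  rewrite ler_pdivrMl ?ltr0n //; apply: le_trans (ler_norm_sum _ _ _) _.
  apply: le_trans (_ : \sum_(x <- r k) e <= _).
    rewrite !big_seq; apply: ler_sum => x /r01/andP[x0 x1].
    by apply: he; rewrite in_itv /= !ltW.
  by rewrite big_const_seq count_predT szr iter_addr_0 mulr_natl.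
- move=> b h h' ch ch'; rewrite /I.
  under eq_Rintegral do rewrite mulrDl -mulrA.
  have i1 := integrable_within_continuousM h w ch iw.
  have i2 := integrable_within_continuousM h' w ch' iw.
  rewrite RintegralD ?RintegralZl //.
  exact: (integrable_within_continuousM (fun=> b) _ (cC b) i1).
- move=> h e ch he; have i1 := integrable_within_continuousM h w ch iw.
  apply: le_trans (le_normr_Rintegral _ i1) _ => //.
  rewrite mulrC -RintegralZl //; last exact: integrable_norm.
  apply: le_Rintegral => //.
  + exact: integrable_norm.
  + exact: (integrable_within_continuousM (fun=> e) _ (cC e) (integrable_norm iw)).
  + move=> x xD; rewrite normrM ler_wpM2r // he //; exact: subset_itv_oo_cc.
- by move=> z z0; rewrite /I Rintegral_resolvent_qMP_angle //; exact: Lres.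
Unshelve. all: by end_near. Qed.
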